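(* Let $\mu_0\in\mathcal{P}(\mathbb{N}^* )$ be such that there exists $\alpha>0$ with $$\inf_{t\in\mathbb{N}^*}\frac{\mu_0(t)}{\sum_{s\ge t}\mu_0(s)}\ge\alpha .$$ Define $\mu=(\mu_\Delta)_{\Delta\in\mathbb{N}}$ by $$\mu_\Delta(t)=\frac{\sqrt{\mu_0(t)\mu_0(t+\Delta)}}{\sum_{s\in\mathbb{N}^*}\sqrt{\mu_0(s)\mu_0(s+\Delta)}},\qquad \Delta\in\mathbb{N},\ t\in\mathbb{N}^*.$$ Then, for any $L\in\mathbb{N}^*$, any $b\in\mathcal{B}_L$ and any $t\in\mathcal{T}_b$, the unique invariant law $\tilde\nu_L$ of the Markov chain $(\tilde F_n)_{n\in\mathbb{N}}$ of the GLPP with parameter $\mu$ on the cylinder of size $L$ is given by $$\tilde\nu_L((b,t))=\frac{1}{Z_L}W_{(b,t)},\qquad Z_L=\sum_{b\in\mathcal{B}_L}\sum_{t\in\mathcal{T}_b}W_{(b,t)},$$ and so the invariant law $\nu_L$ of $(F_n)_{n\in\mathbb{N}}$ is $$\nu_L(b)=\frac1{Z_L}\sum_{t\in\mathcal{T}_b}W_{(b,t)}.$$ Here $$W_{(b,t)}=\prod_{i:\,b_i=b_{i+1}}\frac{\sqrt{\mu_0(|t_{i+1}-t_i|)}}{\sum_{s\ge1}\sqrt{\mu_0(s)}}\ \times\prod_{i:\,b_i=1,\,b_{i+1}=-1}\left[\left(\sum_{s>\max(t_i,t_{i+1})}\frac{\sqrt{\mu_0(s-t_i)}}{\sum_{r\ge1}\sqrt{\mu_0(r)}}\,\frac{\sqrt{\mu_0(s-t_{i+1})}}{\sum_{r\ge1}\sqrt{\mu_0(r)}}\right)\left(\sum_{s\ge1}\mu_{|t_i-t_{i+1}|}(\min(t_i,t_{i+1})+s)\right)\right],$$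 with $i$ ranging over $\mathbb{Z}/2L\mathbb{Z}$.
   Context: $\mathbb{N}=\{0,1,\dots\}$, $\mathbb{N}^*=\{1,2,\dots\}$. $\mathcal{P}(\mathbb{N}^* )$ is the set of probability measures $\mu$ on $\mathbb{N}^*$ with full support ($\mu(i)>0$ for all $i\in\mathbb{N}^*$). GLPP on the cylinder. For $L\in\mathbb{N}^*$ let $\mathcal{C}_L=\{(x,y): x\in\mathbb{Z}/2L\mathbb{Z},\ y\in\mathbb{N},\ x+y=0 \bmod 2\}$ (its elements are called cells). The Generalised directed Last Passage Percolation (GLPP) with parameter $\mu=(\mu_\Delta)_{\Delta\in\mathbb{N}}\in\mathcal{P}(\mathbb{N}^* )^{\mathbb{N}}$ on the cylinder of size $L$ is the random family $(\tau(z))_{z\in\mathcal{C}_L}$ defined by $\tau((x,0))=0$ for all cells $(x,0)$ and, for $y\ge1$, $$\tau((x,y))=\max(\tau((x-1,y-1)),\tau((x+1,y-1)))+\xi_{(x,y)},$$ where, conditionally on the values of $\tau$ on rows $0,\dots,y-1$, the variables $\xi_{(x,y)}$ of row $y$ are independent and $\xi_{(x,y)}\sim\mu_{|\tau((x-1,y-1))-\tau((x+1,y-1))|}$. Front line. For $i\in\mathbb{Z}/2L\mathbb{Z}$ and $y\in\mathbb{N}$ let $c_i(y)$ be the unique cell of row $y$ whose first coordinate is $i-1$ or $i$; $y\mapsto\tau(c_i(y))$ is strictly increasing. At time $n\in\mathbb{N}$, let $z_i=c_i(h)$ with $h=\max\{y:\tau(c_i(y))\le n\}$. Put $b_{n,i}=-1$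 if $z_i$ has first coordinate $i$, $b_{n,i}=+1$ if $z_i$ has first coordinate $i-1$, and $t_{n,i}=n-\tau(z_i)$. The front line is $F_n=(b_{n,i})_{i}$ and $\tilde F_n=(F_n,(t_{n,i})_{i})$. State spaces. $\mathcal{B}_L=\{(b_i)\in\{-1,+1\}^{\mathbb{Z}/2L\mathbb{Z}}:\sum_i b_i=0\}$. For $b\in\mathcal{B}_L$, $\mathcal{T}_b$ is the set of $(t_i)\in\mathbb{N}^{\mathbb{Z}/2L\mathbb{Z}}$ such that for every $i$: if $b_i=b_{i+1}=1$ then $t_i<t_{i+1}$; if $b_i=b_{i+1}=-1$ then $t_i>t_{i+1}$; if $b_i=-1,b_{i+1}=1$ then $t_i=t_{i+1}$. $\tilde{\mathcal{B}}_L=\{(b,t):b\in\mathcal{B}_L,\ t\in\mathcal{T}_b\}$; $(\tilde F_n)$ is a Markov chain on $\tilde{\mathcal{B}}_L$, ergodic under the hypotheses of the claim. $\nu_L$ denotes the image of $\tilde\nu_L$ under the projection $(b,t)\mapsto b$, i.e. $\nu_L(b)=\sum_{t\in\mathcal{T}_b}\tilde\nu_L((b,t))$. *)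

(* Defs.v *)
From HB Require Import structures.
From mathcomp Require Export all_boot all_order all_algebra.
From mathcomp Require Export all_classical all_reals all_analysis.

Set Implicit Arguments.
Unset Strict Implicit.
Unset Printing Implicit Defensive.

Import Order.TTheory GRing.Theory Num.Theory.
Import numFieldNormedType.Exports.

Local Open Scope classical_set_scope.
Local Open Scope ring_scope.

Definition sum_from (R : realType) (m : nat) (f : nat -> R) : R :=
  limn (fun n => \sum_(m <= s < n) f s).

Definition absdiff (m n : nat) : nat := `|m%:Z - n%:Z|%N.

(* A probability measure on {1, 2, ...} with full support is given by its mass
   function on nat, which vanishes at 0. *)
Definition full_support_law (R : realType) (mu : nat -> R) : Prop :=
  [/\ mu 0%N = 0,
      forall i : nat, (0 < i)%N -> 0 < mu i &
      (\sum_(1 <= i <oo) (mu i)%:E = 1)%E].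

Definition hazard_inf (R : realType) (mu0 : nat -> R) : R :=
  inf [set mu0 t / sum_from t mu0 | t in [set t : nat | (0 < t)%N]].

(* The value at t = 0 is 0 as soon as mu0 0 = 0. *)
Definition glpp_param (R : realType) (mu0 : nat -> R) (Delta t : nat) : R :=
  Num.sqrt (mu0 t * mu0 (t + Delta)%N) /
  sum_from 1 (fun s => Num.sqrt (mu0 s * mu0 (s + Delta)%N)).

(* Z/2LZ is 'Z_(L.*2), which is only meaningful for 0 < L. Families indexed by
   cells are total functions of (x, y); every condition imposed on them bears
   on their values at cells only. *)
Definition is_cell (L : nat) (x : 'Z_(L.*2)) (y : nat) : bool :=
  ~~ odd (x + y).

Section GLPP.
Context (R : realType) (L : nat) (d : measure_display)
  (Omega : measurableType d) (P : probability Omega R).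
Implicit Types xi tau : 'Z_(L.*2) -> nat -> Omega -> nat.

Definition past tau (y : nat) (a : 'Z_(L.*2) -> nat -> nat) : set Omega :=
  [set w | forall x y', is_cell x y' -> (y' <= y)%N -> tau x y' w = a x y'].

(* The last condition is the conditional independence and the conditional law
   of the row y.+1 of xi given the rows 0, ..., y of tau, multiplied by the
   probability of the conditioning event. *)
Definition is_GLPP (mu : nat -> nat -> R) xi tau : Prop :=
  [/\ forall x y, is_cell x y.+1 ->
        measurable_fun setT (xi x y.+1) /\ forall w, (0 < xi x y.+1 w)%N,
      forall x, is_cell x 0 -> forall w, tau x 0%N w = 0%N,
      forall x y, is_cell x y.+1 -> forall w,
        tau x y.+1 w =
          (maxn (tau (x - 1)%R y w) (tau (x + 1)%R y w) + xi x y.+1 w)%N &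
      forall (y : nat) (a : 'Z_(L.*2) -> nat -> nat) (k : 'Z_(L.*2) -> nat),
        P (past tau y a `&`
           [set w | forall x, is_cell x y.+1 -> xi x y.+1 w = k x]) =
        (P (past tau y a) *
         (\prod_(x | is_cell x y.+1)
            mu (absdiff (a (x - 1)%R y) (a (x + 1)%R y)) (k x))%:E)%E].

End GLPP.

Section FrontLine.
Context (L : nat) (Omega : Type) (tau : 'Z_(L.*2) -> nat -> Omega -> nat).

(* First coordinate of the cell c_i(y). *)
Definition column (i : 'Z_(L.*2)) (y : nat) : 'Z_(L.*2) :=
  if is_cell i y then i else i - 1.

(* xget picks the maximum of {y : tau(c_i(y)) <= n}. *)
Definition height (n : nat) (i : 'Z_(L.*2)) (w : Omega) : nat :=
  xget 0%N [set h : nat | (tau (column i h) h w <= n)%N /\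
              forall y : nat, (tau (column i y) y w <= n)%N -> (y <= h)%N].

Definition front_line (n : nat) (w : Omega) : {ffun 'Z_(L.*2) -> int} :=
  [ffun i => if column i (height n i w) == i then -1 else 1].

Definition front_times (n : nat) (w : Omega) : {ffun 'Z_(L.*2) -> nat} :=
  [ffun i => (n - tau (column i (height n i w)) (height n i w) w)%N].

Definition Ftilde (n : nat) (w : Omega) :
    {ffun 'Z_(L.*2) -> int} * {ffun 'Z_(L.*2) -> nat} :=
  (front_line n w, front_times n w).

End FrontLine.

Definition Bset (L : nat) : set {ffun 'Z_(L.*2) -> int} :=
  [set b : {ffun 'Z_(L.*2) -> int} |
     (forall i, b i = -1 \/ b i = 1) /\ \sum_i b i = 0].

Definition Tset (L : nat) (b : {ffun 'Z_(L.*2) -> int}) :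
    set {ffun 'Z_(L.*2) -> nat} :=
  [set t : {ffun 'Z_(L.*2) -> nat} | forall i,
     [/\ b i = 1 -> b (i + 1)%R = 1 -> (t i < t (i + 1)%R)%N,
         b i = -1 -> b (i + 1)%R = -1 -> (t (i + 1)%R < t i)%N &
         b i = -1 -> b (i + 1)%R = 1 -> t i = t (i + 1)%R]].

Definition Btilde (L : nat) :
    set ({ffun 'Z_(L.*2) -> int} * {ffun 'Z_(L.*2) -> nat}) :=
  [set bt | Bset bt.1 /\ Tset bt.1 bt.2].
Arguments Btilde : clear implicits.

(* Laws on S are mass functions on the ambient type vanishing outside S. *)
Definition is_law (R : realType) (T : choiceType) (S : set T) (nu : T -> R) :
    Prop :=
  [/\ forall x, 0 <= nu x,
      forall x, ~ S x -> nu x = 0 &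
      \esum_(x in S) (nu x)%:E = 1%E].

Definition is_markov_chain (R : realType) (d : measure_display)
    (Omega : measurableType d) (P : probability Omega R) (T : choiceType)
    (S : set T) (X : nat -> Omega -> T) (K : T -> T -> R) : Prop :=
  [/\ forall x, S x -> is_law S (K x),
      forall n w, S (X n w),
      forall n x, measurable [set w | X n w = x] &
      forall (n : nat) (x : nat -> T),
        P [set w | forall k, (k <= n.+1)%N -> X k w = x k] =
        (P [set w | forall k, (k <= n)%N -> X k w = x k] *
         (K (x n) (x n.+1))%:E)%E].

Definition is_invariant_law (R : realType) (T : choiceType) (S : set T)
    (K : T -> T -> R) (nu : T -> R) : Prop :=
  is_law S nu /\
  forall y, S y -> (\esum_(x in S) (nu x * K x y)%:E = (nu y)%:E)%E.

Definition is_unique_invariant_law (R : realType) (T : choiceType) (S : set T)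
    (K : T -> T -> R) (nu : T -> R) : Prop :=
  is_invariant_law S K nu /\
  forall nu' : T -> R, is_invariant_law S K nu' -> nu' =1 nu.

Section Weights.
Context (R : realType) (mu0 : nat -> R) (L : nat).
Implicit Types (b : {ffun 'Z_(L.*2) -> int}) (t : {ffun 'Z_(L.*2) -> nat}).

Definition sqrt_law (s : nat) : R :=
  Num.sqrt (mu0 s) / sum_from 1 (fun r => Num.sqrt (mu0 r)).

Definition weight b t : R :=
  (\prod_(i | b i == b (i + 1)%R) sqrt_law (absdiff (t (i + 1)%R) (t i))) *
  \prod_(i | (b i == 1) && (b (i + 1)%R == -1))
    (sum_from (maxn (t i) (t (i + 1)%R)).+1
       (fun s => sqrt_law (s - t i) * sqrt_law (s - t (i + 1)%R)) *
     sum_from 1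
       (fun s => glpp_param mu0 (absdiff (t i) (t (i + 1)%R))
                   (minn (t i) (t (i + 1)%R) + s))).

Definition partition_function : \bar R :=
  \esum_(b in @Bset L) \esum_(t in Tset b) (weight b t)%:E.

End Weights.
Arguments partition_function {R} mu0 L.

Definition front_law (R : realType) (L : nat)
    (nut : {ffun 'Z_(L.*2) -> int} * {ffun 'Z_(L.*2) -> nat} -> R)
    (b : {ffun 'Z_(L.*2) -> int}) : \bar R :=
  \esum_(t in Tset b) (nut (b, t))%:E.

(* Main.v *)
Require Import Defs.
From mathcomp Require Import ring lra zify.

Import Order.TTheory GRing.Theory Num.Theory.
Import numFieldNormedType.Exports.

Set Implicit Arguments.
Unset Strict Implicit.
Unset Printing Implicit Defensive.

Local Open Scope classical_set_scope.
Local Open Scope ring_scope.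

(** Write q for the normalised square root of mu0 and
    G(a, c) = sum_(s >= 1) q(a + s) q(c + s).
    Since mu_D(t) = q(t) q(t + D) / G(0, D), the two sums that the weight attaches
    to a hole, that is to a link (i, i + 1) with b_i = 1 and b_(i+1) = -1, collapse
    into G(t_i, t_(i+1)) (hole_weightE).  The next cell fits exactly in such a hole,
    and given that it is not there yet it appears one unit of time later with
    probability q(t_i + 1) q(t_(i+1) + 1) / G(t_i, t_(i+1)), the hazard of
    mu_|t_i - t_(i+1)| at the age of the hole.

    Invariance (esum_weight_kernel).  During one unit of time the holes fill
    independently.  The weight of a hole times the probability that it stays is
    G(t_i + 1, t_(i+1) + 1), the weight of the same hole one unit older; its weight
    times the probability that it fills is q(t_i + 1) q(t_(i+1) + 1), a product in
    which the two times are decoupled.  A state y shows which cells have just been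
    added, so that its predecessors are known up to the times hidden below the new
    cells, and each of those times now interacts with a single link.  The sum over
    the predecessors is therefore a product over the links of sums over one time
    each, and every such sum is a value of q or of G: it is the weight of the link
    in y.

    The front as a Markov chain (front_markov_chain).  The definition of the process
    is row by row, whereas the chain runs in time.  The front up to time n gives the
    same information as the whole table truncated at time n + 1 (front_same_until),
    and the law of the truncated table is a product over the cells, by induction on
    the rows (probability_rows_event).  From n to n + 1 the only factors that change
    belong to the holes of the front, and each of them is multiplied by the
    probability that its hole does what it does (probability_until_eventS).

    Uniqueness.  Any state is the front of some table (realize_state), so the chain
    visits it with positive probability and its transition kernel is determined; and
    from any state the front can be flattened into the initial one (flatten_table).
    The minimum of two invariant laws is again invariant and equals one of them at
    the initial state, hence everywhere (invariant_law_unique).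

    Finiteness of the partition function.  The bound on the hazard rate makes q
    decay geometrically, hence also the weight in all variations |t_(i+1) - t_i|;
    since there is always a hole, and its weight decays in t_i + t_(i+1), the weight
    is dominated by a product of geometric weights in the t_i
    (link_product_geometric). *)

(** * Unconditional sums *)

Section Esum.
Variable R : realType.

Lemma subset_esum (T : choiceType) (A B : set T) (a : T -> \bar R) :
  A `<=` B -> (\esum_(x in A) a x <= \esum_(x in B) a x)%E.
Proof.
move=> AB; apply: ereal_sup_le => _ [X [finX XA] <-].
by exists X => //; split => // x /XA /AB.
Qed.

Lemma esumZ (T : choiceType) (D : set T) (c : R) (f : T -> R) :
  0 <= c -> (forall x, 0 <= f x) ->
  (\esum_(x in D) (c * f x)%:E = c%:E * \esum_(x in D) (f x)%:E)%E.
Proof.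
move=> c0 f0; rewrite /esum -ereal_supZl//; last first.
  by apply/set0P; exists 0%E; exists set0; [exact: fsets_set0|rewrite fsbig_set0].
congr ereal_sup; rewrite image_comp/=; apply: eq_imagel => X _ /=.
by rewrite ge0_mule_fsumr//= => i; rewrite lee_fin.
Qed.

Lemma esum_single (T : choiceType) (D : set T) (x0 : T) (v : \bar R) :
  D x0 -> (0 <= v)%E -> (\esum_(x in D) (if x == x0 then v else 0) = v)%E.
Proof.
move=> Dx0 v0; rewrite (esumID [set x0]); last by move=> i _; case: ifP.
rewrite setI1 mem_set// esum_set1 ?eqxx// esum1 ?adde0// => x [_ /= /eqP/negbTE ->//].
Qed.

Lemma esum_finType (I : finType) (a : I -> \bar R) :
  (forall i, 0 <= a i)%E -> (\esum_(i in [set: I]) a i = \sum_i a i)%E.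
Proof.
move=> a0; transitivity (\esum_(i in [set: I]) \sum_j (if i == j then a j else 0))%E.
  apply: eq_esum => i _; rewrite (bigD1 i)//= eqxx big1 ?adde0// => j /negbTE.
  by rewrite eq_sym => ->.
rewrite esum_sum; last by move=> i j _ _; case: ifP.
by apply: eq_bigr => j _; rewrite esum_single.
Qed.

(** The difference g - f is nonnegative and its total is zero. *)
Lemma esum_eq_le (T : choiceType) (D : set T) (f g : T -> R) :
  (forall x, 0 <= f x) -> (forall x, D x -> f x <= g x) ->
  (\esum_(x in D) (g x)%:E <= \esum_(x in D) (f x)%:E)%E ->
  (\esum_(x in D) (f x)%:E < +oo)%E -> forall x, D x -> f x = g x.
Proof.
move=> f0 fg gf foo x Dx.
have gE : (\esum_(x in D) (g x)%:E =
    \esum_(x in D) (f x)%:E + \esum_(x in D) (g x - f x)%:E)%E.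
  rewrite -esumD//; last by move=> i Di; rewrite lee_fin subr_ge0 fg.
  - by apply: eq_esum => i _; rewrite -EFinD addrC subrK.
  - by move=> i _; rewrite lee_fin.
have ffin : (\esum_(x in D) (f x)%:E \is a fin_num)%E.
  by rewrite ge0_fin_numE//; apply: esum_ge0 => i Di; rewrite lee_fin.
move: gf; rewrite gE -[X in (_ <= X)%E]adde0 leeD2lE// => le0.
have := le_trans _ le0; move=> /(_ (g x - f x)%:E) H.
have: ((g x - f x)%:E <= 0)%E.
  apply: H; rewrite -(@esum_set1 R T x (fun x => (g x - f x)%:E)).
    by apply: subset_esum => _ ->.
  by rewrite lee_fin subr_ge0 fg.
rewrite lee_fin subr_le0 => gfx; apply/eqP; rewrite eq_le gfx andbT; exact: fg.
Qed.

Lemma esum_support (T : choiceType) (A B : set T) (a : T -> \bar R) :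
  (forall x, a x != 0 -> (A x <-> B x)) ->
  (\esum_(x in A) a x = \esum_(x in B) a x)%E.
Proof.
move=> AB; rewrite esum_mkcond [RHS]esum_mkcond; apply: eq_esum => x _.
have [a0|/AB ABx] := eqVneq (a x) 0; first by rewrite a0; do 2!case: ifP.
by rewrite (_ : (x \in A) = (x \in B))//; apply/idP/idP; rewrite !inE => /ABx.
Qed.

Lemma cvg_partial_esum (f : nat -> R) v : (forall s, 0 <= f s) ->
  (\esum_(s in setT) (f s)%:E = v%:E)%E ->
  (fun N => \sum_(0 <= s < N) f s) @ \oo --> v.
Proof.
move=> f0; rewrite -nneseries_esumT; last by move=> s; rewrite lee_fin.
move=> fv; have : (fun N => \sum_(0 <= s < N) (f s)%:E)%E @ \oo --> v%:E.
  by rewrite -fv; apply: is_cvg_nneseries => n _ _; rewrite lee_fin.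
under eq_fun do rewrite sumEFin.
by move/fine_cvgP => -[].
Qed.

Section Product.
Variables (I : finType) (H : I -> nat -> R) (v : I -> R).
Hypothesis H0 : forall i s, 0 <= H i s.
Hypothesis Hv : forall i, (\esum_(s in setT) (H i s)%:E = (v i)%:E)%E.

Let box N : set {ffun I -> nat} := [set u | forall i, (u i < N)%N].

Let esum_box N : (\esum_(u in box N) (\prod_i H i (u i))%:E =
  (\prod_i \sum_(s < N) H i s)%:E)%E.
Proof.
pose e (g : {ffun I -> 'I_N}) : {ffun I -> nat} := [ffun i => val (g i)].
have -> : box N = e @` setT.
  apply/seteqP; split => [u uN|_ [g _ <-] i]; last by rewrite ffunE ltn_ord.
  by exists [ffun i => Ordinal (uN i)] => //; apply/ffunP => i; rewrite !ffunE.
rewrite esum_image; last first.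
  move=> g g' _ _ /ffunP gg'; apply/ffunP => i; apply: val_inj.
  by have := gg' i; rewrite !ffunE.
rewrite esum_finType; last by move=> g; rewrite lee_fin prodr_ge0.
rewrite bigA_distr_bigA/= -sumEFin; apply: eq_bigr => g _; congr EFin.
by apply: eq_bigr => i _; rewrite ffunE.
Qed.

(** Both sides are limits of the finite sums over the boxes [0, N[^I, for which
   the identity is distributivity. *)
Lemma esum_prod_ffun : (\esum_(u in [set: {ffun I -> nat}])
  (\prod_i H i (u i))%:E = (\prod_i v i)%:E)%E.
Proof.
have partial_le i N : \sum_(s < N) H i s <= v i.
  rewrite -lee_fin -Hv -sumEFin -(big_mkord xpredT (fun s => (H i s)%:E))
    -nneseries_esumT; last first.
    by move=> s; rewrite lee_fin.
  by apply: nneseries_lim_ge => k _; rewrite lee_fin.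
apply/eqP; rewrite eq_le; apply/andP; split.
- apply: ge_ereal_sup => _ [X [finX _] <-].
  rewrite -esum_fset//; last by move=> u _; rewrite lee_fin prodr_ge0.
  pose N := (\max_(u <- finmap.enum_fset (fset_set X)) \max_i u i).+1.
  apply: (@le_trans _ _ (\esum_(u in box N) (\prod_i H i (u i))%:E)%E).
    apply: subset_esum => u Xu i; rewrite ltnS.
    apply: (@leq_trans (\max_i u i)); first exact: (leq_bigmax (F := fun i => u i)).
    apply: (@leq_bigmax_seq _ _ xpredT (fun u : {ffun I -> nat} => \max_i u i)) => //.
    by rewrite in_fset_set// inE.
  rewrite esum_box lee_fin; apply: ler_prod => i _.
  by rewrite sumr_ge0//= partial_le.
- set E := (X in (_ <= X)%E).
  have E0 : (0 <= E)%E by apply: esum_ge0 => u _; rewrite lee_fin prodr_ge0.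
  have boxE N : ((\prod_i \sum_(s < N) H i s)%:E <= E)%E.
    by rewrite -esum_box; apply: subset_esum.
  have [->|Eoo] := eqVneq E +oo%E; first by rewrite leey.
  have Efin : E \is a fin_num by rewrite ge0_fin_numE// lt_neqAle Eoo leey.
  rewrite -(fineK Efin) lee_fin.
  have cvgP : (fun N => \prod_i \sum_(s < N) H i s) @ \oo --> \prod_i v i.
    elim: (index_enum I) => [|i r IH].
      by under eq_fun do rewrite big_nil; rewrite big_nil; exact: cvg_cst.
    under eq_fun do rewrite big_cons; rewrite big_cons.
    apply: cvgM => //; under eq_fun do rewrite -(big_mkord xpredT (H i)).
    exact: cvg_partial_esum.
  rewrite -(cvg_lim _ cvgP)//; apply: limr_le; first by apply/cvg_ex; eexists; exact: cvgP.
  by apply: nearW => N; rewrite -lee_fin fineK.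
Qed.

End Product.
End Esum.

(** * The square-root law and its correlation sums *)

Section NatSeries.
Variable R : realType.
Implicit Types f : nat -> R.

Lemma esum_nat_recl f : (forall s, 0 <= f s) ->
  (\esum_(s in setT) (f s)%:E = (f 0%N)%:E + \esum_(s in setT) (f s.+1)%:E)%E.
Proof.
move=> f0; rewrite (esumID [set 0%N]); last by move=> s _; rewrite lee_fin.
rewrite !setTI esum_set1 ?lee_fin//; congr adde.
apply: reindex_esum; split => [s _ //|s t _ _ []//|[|s] //= _].
by exists s.
Qed.

Lemma sum_fromE m f v : (forall s, 0 <= f s) ->
  (\esum_(s in setT) (f (m + s)%N)%:E = v%:E)%E -> sum_from m f = v.
Proof.
move=> f0 fv; apply/cvg_lim => //.
rewrite -(cvg_shiftn m)/=.
under eq_fun do rewrite -{1}[m]add0n big_addn addnK.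
apply: cvg_partial_esum => //.
by rewrite -fv; apply: eq_esum => s _; rewrite addnC.
Qed.

Lemma esum_geometric_le f (K b : R) : 0 < b < 1 -> (forall s, 0 <= f s) ->
  (forall s, f s <= K * b ^+ s) ->
  (\esum_(s in setT) (f s)%:E <= (K * (1 - b)^-1)%:E)%E.
Proof.
move=> /andP[b0 b1] f0 fK; rewrite -nneseries_esumT; last first.
  by move=> s; rewrite lee_fin.
have K0 : 0 <= K by have := le_trans (f0 0%N) (fK 0%N); rewrite expr0 mulr1.
apply: lime_le; first by apply: is_cvg_nneseries => n _ _; rewrite lee_fin.
apply: nearW => n; rewrite sumEFin lee_fin.
apply: le_trans (geometric_le_lim n K0 b0 _); last by rewrite gtr0_norm.
by rewrite /series/=; apply: ler_sum => i _; exact: fK.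
Qed.

Lemma esum_fineK (T : choiceType) (D : set T) (f : T -> R) :
  (forall s, 0 <= f s) -> (\esum_(s in D) (f s)%:E < +oo)%E ->
  (\esum_(s in D) (f s)%:E = (fine (\esum_(s in D) (f s)%:E))%:E)%E.
Proof.
move=> f0 foo; rewrite fineK// ge0_fin_numE//; apply: esum_ge0 => s _.
by rewrite lee_fin.
Qed.

Lemma esum_shift f m : (forall s, 0 <= f s) ->
  (forall s, (s < m)%N -> f s = 0) ->
  (\esum_(s in setT) (f s)%:E = \esum_(s in setT) (f (m + s)%N)%:E)%E.
Proof.
move=> f0; elim: m => [|m IH] fm.
  by apply: eq_esum.
rewrite IH; last by move=> s sm; rewrite fm// ltnW.
rewrite (esum_nat_recl (f := fun s => f (m + s)%N))// addn0 fm// add0e.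
by apply: eq_esum => s _; rewrite addnS.
Qed.

End NatSeries.

Lemma absdiffC a c : absdiff a c = absdiff c a.
Proof. by rewrite /absdiff; lia. Qed.

Lemma absdiffE a c : (a <= c)%N -> absdiff a c = (c - a)%N.
Proof. by move=> ac; rewrite /absdiff; lia. Qed.

Lemma absdiff_leD a c : (absdiff a c <= a + c)%N.
Proof. by rewrite /absdiff; lia. Qed.

Lemma leq_absdiff a c : (c <= a + absdiff a c)%N.
Proof. by rewrite /absdiff; lia. Qed.

Lemma bernoulli_le (R : realFieldType) (u : R) m :
  0 <= u <= 1 -> 1 - m%:R * u <= (1 - u) ^+ m.
Proof.
move=> u01; elim: m => [|m IH]; first by rewrite expr0 mul0r subr0.
rewrite exprS; apply: (@le_trans _ _ ((1 - u) * (1 - m%:R * u))).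
  rewrite -natr1; have : 0 <= m%:R * u * u.
    by rewrite -mulrA mulr_ge0// mulr_ge0//; case/andP: u01.
  lra.
by rewrite ler_wpM2l// subr_ge0; case/andP: u01.
Qed.

Section Weights.
Variables (R : realType) (mu0 : nat -> R) (alpha : R).
Hypotheses (hmu0 : full_support_law mu0) (halpha : 0 < alpha)
  (hinf : alpha <= hazard_inf mu0).

Local Notation q := (sqrt_law mu0).

Lemma mu0_ge0 s : 0 <= mu0 s.
Proof. by case: hmu0 => m0 mp _; case: s => [|s]; rewrite ?m0// ltW ?mp. Qed.

Let mu0_gt0 s : 0 < mu0 s.+1. Proof. by case: hmu0 => _ mp _; exact: mp. Qed.

Lemma esum_mu0 : (\esum_(s in setT) (mu0 s.+1)%:E = 1)%E.
Proof.
case: hmu0 => m0 mp m1.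
have : (\esum_(s in setT) (mu0 s)%:E = 1)%E.
  rewrite -m1 -nneseries_esumT; last by move=> s; rewrite lee_fin mu0_ge0.
  by rewrite nneseries_recl ?m0 ?add0e// => k; rewrite lee_fin mu0_ge0.
by rewrite esum_nat_recl ?m0 ?add0e//; exact: mu0_ge0.
Qed.

Let tail t : R := fine (\esum_(s in setT) (mu0 (t + s)%N)%:E).

Let tailE t : (\esum_(s in setT) (mu0 (t + s)%N)%:E = (tail t)%:E)%E.
Proof.
apply: (esum_fineK (f := fun s => mu0 (t + s)%N)); first by move=> s; exact: mu0_ge0.
elim: t => [|t].
  rewrite esum_nat_recl; last by move=> s; exact: mu0_ge0.
  by rewrite /= esum_mu0 lte_add_pinfty ?ltry.
rewrite (esum_nat_recl (f := fun s => mu0 (t + s)%N)); last by move=> s; exact: mu0_ge0.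
under eq_esum do rewrite addnS -addSn.
by apply: le_lt_trans; rewrite leeDr// lee_fin mu0_ge0.
Qed.

Let tail_rec t : tail t = mu0 t + tail t.+1.
Proof.
apply: EFin_inj; rewrite EFinD -!tailE esum_nat_recl; last by move=> s; exact: mu0_ge0.
by rewrite addn0; congr adde; apply: eq_esum => s _; rewrite addnS.
Qed.

Let tail1 : tail 1 = 1.
Proof. by apply: EFin_inj; rewrite -tailE esum_mu0. Qed.

Let tail_ge0 t : 0 <= tail t.
Proof. by apply: fine_ge0; apply: esum_ge0 => s _; rewrite lee_fin mu0_ge0. Qed.

Let hazard t : alpha * tail t.+1 <= mu0 t.+1.
Proof.
have t0 : 0 < tail t.+1 by rewrite tail_rec ltr_wpDr.
rewrite -ler_pdivlMr//; apply: le_trans hinf _.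
apply: ge_inf.
  exists 0 => _ [s s0 <-]; apply: divr_ge0; first exact: mu0_ge0.
  by rewrite (@sum_fromE _ s mu0 (tail s)) ?tail_ge0//; exact: mu0_ge0.
exists t.+1 => //=; rewrite (@sum_fromE _ t.+1 mu0 (tail t.+1))//.
exact: mu0_ge0.
Qed.

Let alpha_lt1 : alpha < 1.
Proof.
have h0 := hazard 0; have m2 := mu0_gt0 1; have t1 := tail_rec 1.
have t2 := tail_rec 2; have t3 := tail_ge0 3.
rewrite tail1 mulr1 in h0; rewrite tail1 in t1.
lra.
Qed.

Let tail_le t : tail t.+1 <= (1 - alpha) ^+ t.
Proof.
elim: t => [|t IH]; first by rewrite tail1 expr0.
rewrite exprS; apply: (@le_trans _ _ ((1 - alpha) * tail t.+1)).
  by have := hazard t; have := tail_rec t.+1; lra.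
by rewrite ler_pM2l// subr_gt0.
Qed.

(** The hazard bound says that removing its first term from a tail of mu0 divides
    it by at least 1 / (1 - alpha), so that mu0 and its square root are dominated by
    geometric sequences. *)
Lemma sqrt_mu0_geometric : exists b : R, exists2 K : R, 0 < b < 1 &
  forall s, Num.sqrt (mu0 s) <= K * b ^+ s.
Proof.
have a1 : 0 < 1 - alpha by rewrite subr_gt0.
pose b := Num.sqrt (1 - alpha).
have b0 : 0 < b by rewrite sqrtr_gt0.
exists b; exists b^-1.
  by rewrite b0/=; have : b < Num.sqrt 1 by [rewrite ltr_sqrt// gtrBl]; rewrite sqrtr1.
case=> [|s].
  by case: hmu0 => -> _ _; rewrite sqrtr0 expr0 mulr1 invr_ge0 ltW.
rewrite exprS mulKf ?gt_eqF// -[b ^+ s]ger0_norm ?exprn_ge0 ?(ltW b0)// -sqrtr_sqr.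
rewrite -exprM mulnC exprM sqr_sqrtr ?(ltW a1)// ler_sqrt ?exprn_ge0 ?(ltW a1)//.
by apply: le_trans (tail_le s); rewrite tail_rec lerDl tail_ge0.
Qed.

Let norm : R := sum_from 1 (fun r => Num.sqrt (mu0 r)).

Let norm_gt0 : 0 < norm.
Proof.
have [b [K b01 bK]] := sqrt_mu0_geometric.
have s0 s : 0 <= Num.sqrt (mu0 s) by exact: sqrtr_ge0.
have sfin : (\esum_(s in setT) (Num.sqrt (mu0 (1 + s)%N))%:E < +oo)%E.
  apply: le_lt_trans (@esum_geometric_le _ _ (K * b) b b01 _ _) (ltry _) => //.
  by move=> s; rewrite -mulrA -exprS.
have fK := esum_fineK (f := fun s => Num.sqrt (mu0 (1 + s)%N)) (fun s => s0 _) sfin.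
rewrite /norm (sum_fromE _ fK)//.
rewrite -lte_fin -fK esum_nat_recl; last by [].
apply: (@lt_le_trans _ _ (Num.sqrt (mu0 1))%:E); first by rewrite lte_fin sqrtr_gt0.
by rewrite leeDl//; apply: esum_ge0 => s _; rewrite lee_fin.
Qed.

Lemma sqrt_law0 : q 0 = 0.
Proof. by rewrite /sqrt_law; case: hmu0 => -> _ _; rewrite sqrtr0 mul0r. Qed.

Lemma sqrt_law_gt0 s : 0 < q s.+1.
Proof. by rewrite /sqrt_law divr_gt0// sqrtr_gt0. Qed.

Lemma sqrt_law_ge0 s : 0 <= q s.
Proof. by case: s => [|s]; rewrite ?sqrt_law0// ltW ?sqrt_law_gt0. Qed.

Lemma sqrt_law_geometric : exists b : R, exists2 K : R, 0 < b < 1 /\ 0 < K &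
  forall s, q s <= K * b ^+ s.
Proof.
have [b [K b01 bK]] := sqrt_mu0_geometric.
have K0 : 0 < K.
  have: 0 < Num.sqrt (mu0 1) by rewrite sqrtr_gt0.
  move=> /lt_le_trans /(_ (bK 1%N)); rewrite expr1.
  by case/andP: b01 => b0 _; rewrite pmulr_lgt0.
exists b; exists (K / norm); first by split=> //; rewrite divr_gt0.
by move=> s; rewrite mulrAC ler_pM2r ?invr_gt0.
Qed.

(** Every sum in the weight and in the jump rates is a value of this function; for
    a hole, its arguments are the times of the two parents. *)
Definition corr (a c : nat) : R :=
  fine (\esum_(s in setT) (q (a + s).+1 * q (c + s).+1)%:E).

Let qq_ge0 a c s : 0 <= q (a + s).+1 * q (c + s).+1.
Proof. by rewrite mulr_ge0 ?sqrt_law_ge0. Qed.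

Lemma corr_geometric_esum : exists b : R, exists2 K : R, 0 < b < 1 &
  forall a c, (\esum_(s in setT) (q (a + s).+1 * q (c + s).+1)%:E <=
    (K * b ^+ (a + c))%:E)%E.
Proof.
have [b [K [b01 K0] bK]] := sqrt_law_geometric; exists b.
exists (K ^+ 2 * (1 - b)^-1) => // a c.
have b0 : 0 <= b by case/andP: b01 => /ltW.
have b1 : b <= 1 by case/andP: b01 => _ /ltW.
rewrite mulrAC; apply: esum_geometric_le => // s.
apply: le_trans (ler_pM _ _ (bK _) (bK _)) _; rewrite ?sqrt_law_ge0//.
rewrite mulrACA -expr2 -exprD -[leRHS]mulrA -exprD ler_pM2l ?exprn_gt0//.
by rewrite ler_wiXn2l//; lia.
Qed.

Lemma corrE a c : (\esum_(s in setT) (q (a + s).+1 * q (c + s).+1)%:E =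
  (corr a c)%:E)%E.
Proof.
apply: (esum_fineK (f := fun s => q (a + s).+1 * q (c + s).+1)) => //.
have [b [K _ bK]] := corr_geometric_esum.
exact: le_lt_trans (bK a c) (ltry _).
Qed.

Lemma corr_geometric : exists b : R, exists2 K : R, 0 < b < 1 &
  forall a c, corr a c <= K * b ^+ (a + c).
Proof.
have [b [K b01 bK]] := corr_geometric_esum; exists b; exists K => // a c.
by rewrite -lee_fin -corrE.
Qed.

(** Ageing a hole by one unit drops the first term of its correlation sum. *)
Lemma corr_rec a c : corr a c = q a.+1 * q c.+1 + corr a.+1 c.+1.
Proof.
apply: EFin_inj; rewrite EFinD -!corrE esum_nat_recl; last by [].
by rewrite !addn0; congr adde; apply: eq_esum => s _; rewrite !addnS !addSn.
Qed.

Lemma corr_ge0 a c : 0 <= corr a c.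
Proof. by apply: fine_ge0; apply: esum_ge0 => s _; rewrite lee_fin. Qed.

Lemma corr_gt0 a c : 0 < corr a c.
Proof. by rewrite corr_rec ltr_wpDr ?corr_ge0// mulr_gt0 ?sqrt_law_gt0. Qed.

Lemma corrC a c : corr a c = corr c a.
Proof. by rewrite /corr; congr fine; apply: eq_esum => s _; rewrite mulrC. Qed.

Lemma glpp_paramE D t : glpp_param mu0 D t = q t * q (t + D) / corr 0 D.
Proof.
rewrite /glpp_param (@sum_fromE _ 1 _ (norm ^+ 2 * corr 0 D)).
- rewrite sqrtrM ?mu0_ge0// /sqrt_law -/norm.
  have := norm_gt0; have := corr_gt0 0 D => /gt_eqF c0 /gt_eqF n0.
  by field; rewrite c0 n0.
- by move=> s; exact: sqrtr_ge0.
- rewrite EFinM -corrE -esumZ ?exprn_ge0 ?(ltW norm_gt0)//; apply: eq_esum => s _.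
  rewrite add1n addSn add0n sqrtrM ?mu0_ge0// /sqrt_law -/norm addnC.
  by congr EFin; field; rewrite gt_eqF.
Qed.

Lemma glpp_param_ge0 D t : 0 <= glpp_param mu0 D t.
Proof.
rewrite glpp_paramE; apply: divr_ge0; last exact: corr_ge0.
by apply: mulr_ge0; exact: sqrt_law_ge0.
Qed.

Lemma glpp_param0 D : glpp_param mu0 D 0 = 0.
Proof. by rewrite glpp_paramE sqrt_law0 !mul0r. Qed.

Lemma glpp_param_tail D t : (\esum_(s in setT)
  (glpp_param mu0 D (t + s).+1)%:E = (corr t (t + D) / corr 0 D)%:E)%E.
Proof.
rewrite mulrC EFinM -corrE -esumZ ?invr_ge0 ?corr_ge0//.
by apply: eq_esum => s _; rewrite glpp_paramE mulrC addSn addnAC.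
Qed.

Lemma glpp_param_sum1 D : (\esum_(s in setT) (glpp_param mu0 D s)%:E = 1)%E.
Proof.
rewrite esum_nat_recl; last by move=> s; exact: glpp_param_ge0.
by rewrite glpp_param0 add0e (glpp_param_tail D 0) divff// gt_eqF// corr_gt0.
Qed.

(** The first sum is the normalising constant of the law mu_|a - c| whose tail is
    the second sum, so their product is a sum of unnormalised terms. *)
Lemma hole_weightE a c :
  sum_from (maxn a c).+1 (fun s => q (s - a) * q (s - c)) *
  sum_from 1 (fun s => glpp_param mu0 (absdiff a c) (minn a c + s)) = corr a c.
Proof.
wlog ac : a c / (a <= c)%N.
  move=> H; case/orP: (leq_total a c) => [/H //|/H].
  rewrite absdiffC maxnC minnC corrC => <-; congr (sum_from _ _ * _).
  by apply/funext => s; rewrite mulrC.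
rewrite (maxn_idPr ac) (minn_idPl ac) absdiffE//.
rewrite (@sum_fromE _ _ _ (corr 0 (c - a))); first last.
- rewrite -corrE; apply: eq_esum => s _; rewrite mulrC; congr (q _ * q _)%:E; lia.
- by move=> s; rewrite mulr_ge0 ?sqrt_law_ge0.
rewrite (@sum_fromE _ _ _ (corr a (a + (c - a)) / corr 0 (c - a))); first last.
- by rewrite -glpp_param_tail; apply: eq_esum => s _; rewrite add1n addnS.
- by move=> s; exact: glpp_param_ge0.
by rewrite subnKC// mulrC divfK// gt_eqF// corr_gt0.
Qed.

End Weights.

(** * Fronts, holes and elementary steps *)

Section States.
Variable L : nat.
Local Notation Z := 'Z_(L.*2).
Local Notation state := ({ffun Z -> int} * {ffun Z -> nat})%type.
Implicit Types (b : {ffun Z -> int}) (t : {ffun Z -> nat}) (x y : state).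
Implicit Types (A : {set Z}) (i j : Z).

(** The cell in column i just above the front has both its parents in the front. *)
Definition hole b i : bool := (b i == 1) && (b (i + 1) == -1).

(** The cell of the hole at i is the new front cell of the columns i and i + 1. *)
Definition filled A j : bool := (j \in A) || (j - 1 \in A).

Definition step x A : state :=
  ([ffun j => if filled A j then - x.1 j else x.1 j],
   [ffun j => if filled A j then 0%N else (x.2 j).+1]).

(** A time coordinate vanishes only in the two columns of a new cell, so the holes
    just filled can be read off the state after the step. *)
Definition new_cells y : {set Z} := [set i | (y.1 i == -1) && (y.2 i == 0%N)].

Lemma filled_hole b A j : (forall i, i \in A -> hole b i) ->
  filled A j -> (j \in A /\ b j = 1) \/ (j - 1 \in A /\ b j = -1).
Proof.
move=> Ah /orP[jA|jA]; [left|right]; split => //.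
  by have /andP[/eqP] := Ah _ jA.
by have /andP[_ /eqP] := Ah _ jA; rewrite subrK.
Qed.

Lemma new_cells_step x A : (forall i, i \in A -> hole x.1 i) ->
  new_cells (step x A) = A.
Proof.
move=> Ah; apply/setP => j; rewrite inE !ffunE.
have [fj|/norP[/negbTE -> _]] := boolP (filled A j); last by rewrite andbF.
rewrite andbT; have [[jA bj]|[jA bj]] := filled_hole Ah fj.
  by rewrite bj jA.
rewrite bj opprK/=; apply/esym/negbTE/negP => /Ah /andP[/eqP].
by rewrite bj.
Qed.

Lemma sum_flip b A : (forall i, i \in A -> b i + b (i + 1) = 0) ->
  (forall i, i \in A -> i + 1 \notin A) ->
  \sum_j (if filled A j then - b j else b j) = \sum_j b j.
Proof.
move=> bA AA.
have E j : (if filled A j then - b j else b j) =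
    b j - 2 * ((if j \in A then b j else 0) + (if j - 1 \in A then b j else 0)).
  rewrite /filled; have := AA (j - 1); rewrite subrK.
  by case: (j \in A); case: (j - 1 \in A) => //= H; try ring; have := H isT.
rewrite (eq_bigr _ (fun j _ => E j)) sumrB -mulr_sumr big_split/=.
rewrite [X in 2 * (_ + X)](reindex_inj (addIr 1))/=.
under [X in 2 * (_ + X)]eq_bigr do rewrite addrK.
rewrite -big_split/= [X in 2 * X]big1 ?mulr0 ?subr0// => i _.
by have := bA i; case: (i \in A) => [->//|_]; rewrite addr0.
Qed.

Section Predecessor.
Variables (y : state).
Hypothesis yS : Btilde L y.

Local Notation b' := (y.1).
Local Notation t' := (y.2).
Local Notation A0 := (new_cells y).

Lemma sign_cases b i : Bset b -> b i = -1 \/ b i = 1.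
Proof. by case=> + _; exact. Qed.

Lemma new_cells_right i : i \in A0 -> b' (i + 1) = 1 /\ t' (i + 1) = 0%N.
Proof.
case: yS => bB tT; rewrite inE => /andP[/eqP bi /eqP ti].
have [_ h1 h2] := tT i; have [bi1|bi1] := sign_cases (i + 1) bB.
  by have := h1 bi bi1; rewrite ti.
by split => //; rewrite -h2.
Qed.

Lemma filled_new j : filled A0 j = (t' j == 0%N).
Proof.
apply/orP/idP => [[|jA]|/eqP tj].
- by rewrite inE => /andP[].
- by have [_ ] := new_cells_right jA; rewrite subrK => ->.
case: yS => bB tT; have [bj|bj] := sign_cases j bB.
  by left; rewrite inE bj eqxx/= tj.
right; have [h1 _ h2] := tT (j - 1); rewrite subrK in h1 h2.
have [bj1|bj1] := sign_cases (j - 1) bB.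
  by rewrite inE bj1 eqxx/= h2// tj.
by have := h1 bj1 bj; rewrite tj.
Qed.

Lemma new_cells_next i : i \in A0 -> i + 1 \notin A0.
Proof.
move=> /new_cells_right[bi _]; rewrite inE bi; exact/negP.
Qed.

(** The signs before the step, obtained by removing the new cells. *)
Definition pred_sign : {ffun Z -> int} :=
  [ffun j => if t' j == 0%N then - b' j else b' j].

Lemma new_cells_hole i : i \in A0 -> hole pred_sign i.
Proof.
move=> iA; have [bi ti] := new_cells_right iA.
move: iA; rewrite inE => /andP[/eqP b0 /eqP t0].
by rewrite /hole !ffunE t0 ti b0 bi !eqxx.
Qed.

Lemma pred_sign_Bset : Bset pred_sign.
Proof.
case: (yS) => [[bB bs] _]; split.
  by move=> i; rewrite ffunE; have := bB i; case: ifP => _ [] ->;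
    rewrite ?opprK; auto.
transitivity (\sum_j (if filled A0 j then - b' j else b' j)).
  by apply: eq_bigr => j _; rewrite ffunE filled_new.
rewrite sum_flip//; last exact: new_cells_next.
move=> i iA; have [-> _] := new_cells_right iA.
by move: iA; rewrite inE => /andP[/eqP ->].
Qed.

Lemma step_newE x : (y == step x A0) =
  (x.1 == pred_sign) && [forall j, (t' j != 0%N) ==> ((x.2 j).+1 == t' j)].
Proof.
apply/eqP/andP => [yE|[/eqP xb /forallP xt]].
  have Eb j : b' j = if filled A0 j then - x.1 j else x.1 j.
    by rewrite {1}yE ffunE.
  have Et j : t' j = if filled A0 j then 0%N else (x.2 j).+1.
    by rewrite {1}yE ffunE.
  split.
    apply/eqP/ffunP => j; rewrite ffunE -filled_new Eb.
    by case: (filled A0 j); rewrite ?opprK.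
  by apply/forallP => j; rewrite -filled_new Et; case: (filled A0 j); rewrite /= ?eqxx.
rewrite [y]surjective_pairing; congr pair; apply/ffunP => j; rewrite !ffunE filled_new.
  by rewrite xb ffunE; case: (t' j == 0%N); rewrite ?opprK.
have := xt j; case: eqP => [-> //|/= _ /eqP -> //].
Qed.

End Predecessor.
End States.

(** * The transition kernel and the invariance of the weight *)

Section KernelDef.
Variables (R : realType) (mu0 : nat -> R) (L : nat).
Local Notation Z := 'Z_(L.*2).
Local Notation state := ({ffun Z -> int} * {ffun Z -> nat})%type.

(** The hazard at min(a, c) + 1 of the law mu_|a - c| of a hole, the times of its
    parents being a and c: see truncated_law_step. *)
Definition fill_prob (a c : nat) : R :=
  sqrt_law mu0 a.+1 * sqrt_law mu0 c.+1 / corr mu0 a c.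

Definition hole_prob (x : state) (i : Z) : R :=
  if hole x.1 i then fill_prob (x.2 i) (x.2 (i + 1)) else 0.

Definition fill_rate (x : state) (A : {set Z}) : R :=
  \prod_i (if i \in A then hole_prob x i else 1 - hole_prob x i).

Definition fill_kernel (x y : state) : R :=
  \sum_(A : {set Z}) fill_rate x A * (y == step x A)%:R.

(** As q 0 = 0 and subtraction is truncated, the weight of a link vanishes when the
    link violates the constraint that defines T_b. *)
Definition link_weight (e e' : int) (a c : nat) : R :=
  if e == 1 then (if e' == 1 then sqrt_law mu0 (c - a) else corr mu0 a c)
  else (if e' == 1 then (a == c)%:R else sqrt_law mu0 (a - c)).

Definition link_product (x : state) : R :=
  \prod_i link_weight (x.1 i) (x.1 (i + 1)) (x.2 i) (x.2 (i + 1)).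

End KernelDef.

Section Invariance.
Variables (R : realType) (mu0 : nat -> R) (alpha : R).
Hypotheses (hmu0 : full_support_law mu0) (halpha : 0 < alpha)
  (hinf : alpha <= hazard_inf mu0).
Variable L : nat.
Local Notation Z := 'Z_(L.*2).
Local Notation state := ({ffun Z -> int} * {ffun Z -> nat})%type.
Local Notation q := (sqrt_law mu0).
Local Notation G := (corr mu0).
Implicit Types (x y : state) (A : {set Z}) (i j : Z).

Let q0 : q 0 = 0 := sqrt_law0 hmu0.
Let q_gt0 s : 0 < q s.+1. Proof. exact: (sqrt_law_gt0 hmu0 halpha hinf). Qed.
Let q_ge0 s : 0 <= q s. Proof. exact: (sqrt_law_ge0 hmu0 halpha hinf). Qed.
Let G_gt0 a c : 0 < G a c. Proof. exact: (corr_gt0 hmu0 halpha hinf). Qed.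
Let G_rec a c : G a c = q a.+1 * q c.+1 + G a.+1 c.+1.
Proof. exact: (corr_rec hmu0 halpha hinf). Qed.
Let GE a c : (\esum_(s in setT) (q (a + s).+1 * q (c + s).+1)%:E = (G a c)%:E)%E.
Proof. exact: (corrE hmu0 halpha hinf). Qed.

(** Filling a hole decouples the times of its parents, and a hole that stays only
    gets older: these two identities are what makes the weight invariant. *)
Lemma fill_prob_corr a c : G a c * fill_prob mu0 a c = q a.+1 * q c.+1.
Proof. by rewrite mulrC divfK// gt_eqF. Qed.

Lemma fill_probC_corr a c : G a c * (1 - fill_prob mu0 a c) = G a.+1 c.+1.
Proof. by rewrite mulrBr fill_prob_corr mulr1 G_rec addrC addKr. Qed.

Lemma fill_prob_gt0 a c : 0 < fill_prob mu0 a c.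
Proof. by rewrite divr_gt0// mulr_gt0. Qed.

Lemma fill_prob_lt1 a c : fill_prob mu0 a c < 1.
Proof. by rewrite ltr_pdivrMr// mul1r [ltRHS]G_rec ltrDl. Qed.

Lemma hole_prob_itv x i : 0 <= hole_prob mu0 x i <= 1.
Proof.
rewrite /hole_prob; case: ifP => _; last by rewrite lexx ler01.
by rewrite !ltW ?fill_prob_gt0 ?fill_prob_lt1.
Qed.

Lemma fill_rate_ge0 x A : 0 <= fill_rate mu0 x A.
Proof.
apply: prodr_ge0 => i _; have /andP[p0 p1] := hole_prob_itv x i.
by case: ifP => _ //; rewrite subr_ge0.
Qed.

Lemma fill_rate_neq0 x A : fill_rate mu0 x A != 0 ->
  forall i, i \in A -> hole x.1 i.
Proof.
move/prodf_neq0 => h i iA; have := h i isT; rewrite iA /hole_prob.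
by case: ifP => //; rewrite eqxx.
Qed.

Lemma fill_rate_gt0 x A : (forall i, i \in A -> hole x.1 i) ->
  0 < fill_rate mu0 x A.
Proof.
move=> Ah; apply: prodr_gt0 => i _; rewrite /hole_prob.
case: ifP => [/Ah ->|_]; first exact: fill_prob_gt0.
by case: ifP => _; rewrite subr_gt0 ?fill_prob_lt1.
Qed.

Lemma sum_fill_rate x : \sum_A fill_rate mu0 x A = 1.
Proof.
by rewrite /fill_rate -bigA_distr big1// => i _ /=; rewrite addrC subrK.
Qed.

Lemma fill_kernel_ge0 x y : 0 <= fill_kernel mu0 x y.
Proof. by apply: sumr_ge0 => A _; rewrite mulr_ge0 ?fill_rate_ge0. Qed.

Lemma fill_kernel_neq0 x y : fill_kernel mu0 x y != 0 ->
  exists2 A : {set Z}, (forall i, i \in A -> hole x.1 i) & y = step x A.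
Proof.
move=> K0; have [[A]|nA] := pselect (exists A, fill_rate mu0 x A != 0 /\ y = step x A).
  by move=> [/fill_rate_neq0 ? ?]; exists A.
case/eqP: K0; apply: big1 => A _; case: eqP => [yE|_]; last by rewrite mulr0.
rewrite mulr1; apply/eqP; apply: contrapT => r0; apply: nA; exists A.
by split => //; apply/negP.
Qed.

Lemma fill_kernel_step x A : (forall i, i \in A -> hole x.1 i) ->
  fill_kernel mu0 x (step x A) = fill_rate mu0 x A.
Proof.
move=> Ah; rewrite /fill_kernel (bigD1 A)//= eqxx mulr1 big1 ?addr0// => B BA.
case: eqP => [E|_]; last by rewrite mulr0.
rewrite mulr1; apply/eqP; apply: contraNT BA => /fill_rate_neq0 Bh.
by rewrite -(new_cells_step Ah) E new_cells_step.
Qed.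

Lemma esum_fill_kernel x : (\esum_(y in setT) (fill_kernel mu0 x y)%:E = 1)%E.
Proof.
transitivity (\esum_(y in [set: state]) \sum_A
    (if y == step x A then (fill_rate mu0 x A)%:E else 0))%E.
  apply: eq_esum => y _; rewrite /fill_kernel -sumEFin; apply: eq_bigr => A _.
  by case: eqP; rewrite ?mulr1 ?mulr0.
rewrite esum_sum; last first.
  by move=> y A _ _; case: ifP => // _; rewrite lee_fin fill_rate_ge0.
under eq_bigr do rewrite esum_single ?lee_fin ?fill_rate_ge0//.
by rewrite sumEFin sum_fill_rate.
Qed.

Lemma fill_kernelE x y : fill_kernel mu0 x y =
  fill_rate mu0 x (new_cells y) * (y == step x (new_cells y))%:R.
Proof.
rewrite /fill_kernel (bigD1 (new_cells y))//= big1 ?addr0// => A Ay.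
case: eqP => [yE|_]; last by rewrite mulr0.
rewrite mulr1; apply/eqP; apply: contraNT Ay => /fill_rate_neq0 Ah.
by rewrite yE new_cells_step.
Qed.

Lemma weightE x : Btilde L x -> weight mu0 x.1 x.2 = link_product mu0 x.
Proof.
case=> bB tT; rewrite /weight /link_product.
rewrite big_mkcond [X in _ * X]big_mkcond -big_split/=; apply: eq_bigr => i _.
rewrite (hole_weightE hmu0 halpha hinf) /link_weight; have [h1 h2 h3] := tT i.
have [e|e] := sign_cases i bB; have [e'|e'] := sign_cases (i + 1) bB; rewrite e e' /=.
- by rewrite mulr1 absdiffE// ltnW// h2.
- by rewrite mulr1 h3// eqxx.
- by rewrite mul1r.
- by rewrite mulr1 absdiffC absdiffE// ltnW// h1.
Qed.

Lemma link_product_out x : Bset x.1 -> ~ Tset x.1 x.2 -> link_product mu0 x = 0.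
Proof.
move=> bB tT; apply/eqP; rewrite /link_product prodf_seq_eq0.
apply: contrapT => /negP /hasPn h; apply: tT => i.
have := h i (mem_index_enum i); rewrite /= /link_weight.
have [e|e] := sign_cases i bB; have [e'|e'] := sign_cases (i + 1) bB; rewrite e e' /=.
- move=> qN0; split => // _ _; rewrite ltnNge; apply: contra qN0 => le.
  by rewrite (eqP le) q0.
- by rewrite pnatr_eq0 eqb0 negbK => /eqP ->.
- by [].
- move=> qN0; split => // _ _; rewrite ltnNge; apply: contra qN0 => le.
  by rewrite (eqP le) q0.
Qed.

Lemma link_weight_ge0 (e e' : int) a c : 0 <= link_weight mu0 e e' a c.
Proof.
by rewrite /link_weight; do 2?case: ifP => _ //; rewrite ?ler0n ?ltW.
Qed.

Lemma link_product_ge0 x : 0 <= link_product mu0 x.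
Proof.
by apply: prodr_ge0 => i _; exact: link_weight_ge0.
Qed.

(** Every filled position is an end of exactly one link in A and of exactly one
    link outside A. *)
Lemma prod_links_swap (A : {set Z}) (e : Z -> R) :
  (forall j, ~~ filled A j -> e j = 1) -> (forall i, i \in A -> i + 1 \notin A) ->
  \prod_l (if l \in A then e l * e (l + 1) else 1) =
  \prod_l (if l \in A then 1 else e l * e (l + 1)).
Proof.
move=> e1 AA; transitivity (\prod_j ((if j \in A then e j else 1) *
    (if j - 1 \in A then e j else 1))).
  rewrite big_split/= [X in _ * X](reindex_inj (addIr 1))/= -big_split/=.
  by apply: eq_bigr => l _; rewrite addrK; case: ifP; rewrite ?mulr1.
transitivity (\prod_j ((if j \in A then 1 else e j) *
    (if j - 1 \in A then 1 else e j))); last first.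
  rewrite big_split/= [X in _ * X](reindex_inj (addIr 1))/= -big_split/=.
  by apply: eq_bigr => l _; rewrite addrK; case: ifP; rewrite ?mulr1.
apply: eq_bigr => j _; have := AA (j - 1); have := e1 j; rewrite subrK /filled.
case: (j \in A); case: (j - 1 \in A) => /= e1j AAj; rewrite ?mulr1 ?mul1r//.
  by have := AAj isT.
by rewrite e1j// mulr1.
Qed.

Section Predecessors.
Variable y : state.
Hypothesis yS : Btilde L y.
Let b' := y.1.
Let t' := y.2.
Let A0 := new_cells y.
Let bp := pred_sign y.

(** The time of j before the step: free (the value s) if j has just been filled,
    determined by y otherwise.  A link outside A0 has at most one free time, because
    its two ends shared a front cell before the step if both have just been filled. *)
Let endpoint (j : Z) (s : nat) : nat := if t' j == 0%N then s else (t' j).-1.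
(** The factor that a filled hole contributes for the time of one of its ends. *)
Let exposed (j : Z) (s : nat) : R := if t' j == 0%N then q s.+1 else 1.
(** The links without a free time. *)
Let rigid (l : Z) : bool := (t' l != 0%N) && (t' (l + 1) != 0%N) || (l \in A0).
Let times (u : {ffun Z -> nat}) : {ffun Z -> nat} :=
  [ffun j => endpoint j (if j \in A0 then u (j - 1) else u j)].

(** The weight of the link l before the step, together with the factors of its ends
    once the filled holes have been split; it is concentrated at s = 0 when there is
    no free time, so that each predecessor is counted once. *)
Let factor (l : Z) (s : nat) : R := (if rigid l then (s == 0%N)%:R else 1) *
  (if l \in A0 then 1 else
    link_weight mu0 (bp l) (bp (l + 1)) (endpoint l s) (endpoint (l + 1) s) *
    (if hole bp l then 1 - fill_prob mu0 (endpoint l s) (endpoint (l + 1) s) else 1) *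
    (exposed l s * exposed (l + 1) s)).

Let times_left u l : l \notin A0 -> times u l = endpoint l (u l).
Proof. by rewrite ffunE => /negbTE ->. Qed.

Let times_right u l : l \notin A0 -> times u (l + 1) = endpoint (l + 1) (u l).
Proof.
move=> lA; rewrite ffunE; case: ifP => [|lA1]; first by rewrite addrK.
rewrite /endpoint; have := filled_new yS (l + 1).
by rewrite /filled addrK -/A0 lA1 (negbTE lA) /= => <-.
Qed.

Let new_zero (l : Z) : l \in A0 -> t' l = 0%N /\ t' (l + 1) = 0%N.
Proof.
move=> lA; have [_ ->] := new_cells_right yS lA; split => //.
by move: lA; rewrite inE => /andP[_ /eqP].
Qed.

Let bpE j : bp j = if t' j == 0%N then - b' j else b' j.
Proof. by rewrite ffunE. Qed.

Let new_sign l : l \in A0 -> b' l = -1 /\ b' (l + 1) = 1.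
Proof.
move=> lA; have [-> _] := new_cells_right yS lA; split => //.
by move: lA; rewrite inE => /andP[/eqP].
Qed.

Let old_sign (l : Z) : t' l = 0%N -> l \notin A0 -> b' l = 1.
Proof.
move=> tl lA; have := filled_new yS l; rewrite -/t' tl eqxx /filled -/A0 (negbTE lA)/=.
by move=> /new_sign[_]; rewrite subrK.
Qed.

Let old_next (l : Z) : t' (l + 1) = 0%N -> l \notin A0 -> l + 1 \in A0.
Proof.
move=> tl lA; have := filled_new yS (l + 1).
by rewrite -/t' tl eqxx /filled addrK -/A0 (negbTE lA) orbF.
Qed.

Let step_times u : y == step (bp, times u) A0.
Proof.
rewrite (step_newE yS) eqxx/=; apply/forallP => j; apply/implyP => tj.
by rewrite ffunE /endpoint -/t' (negbTE tj) prednK// lt0n.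
Qed.

Let weight_factor (u : {ffun Z -> nat}) : (forall l, rigid l -> u l = 0%N) ->
  link_product mu0 (bp, times u) * fill_rate mu0 (bp, times u) A0 =
  \prod_l factor l (u l).
Proof.
move=> u0; pose e j := exposed j (times u j).
rewrite /link_product /fill_rate -big_split/=.
pose X l := link_weight mu0 (bp l) (bp (l + 1)) (times u l) (times u (l + 1)) *
  (1 - hole_prob mu0 (bp, times u) l).
transitivity (\prod_l ((if l \in A0 then e l * e (l + 1) else 1) *
    (if l \in A0 then 1 else X l))).
  apply: eq_bigr => l _; case: ifP => lA; last by rewrite mul1r.
  have hl := new_cells_hole yS lA; rewrite mulr1 /hole_prob /= hl.
  move: hl => /andP[/eqP -> /eqP ->]; rewrite /link_weight/= fill_prob_corr.
  by rewrite /e /exposed; have [-> ->] := new_zero lA.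
rewrite big_split/= prod_links_swap; first last.
- exact: new_cells_next yS.
- by move=> j; rewrite (filled_new yS) /e /exposed => /negbTE ->.
rewrite -big_split/=; apply: eq_bigr => l _; rewrite /factor.
have -> : (if rigid l then (u l == 0%N)%:R else 1) = 1 :> R.
  by case: ifP => // /u0 ->.
rewrite mul1r; case: ifP => [|/negbT lA]; first by rewrite mulr1.
rewrite /X /e /hole_prob /= mulrC -times_left// -times_right//.
congr (_ * _ * _); last first.
  rewrite times_right// times_left// /exposed /endpoint.
  by case: (t' l == 0%N); case: (t' (l + 1) == 0%N).
by case: ifP => _ //; rewrite subr0.
Qed.

Let factor_ge0 l s : 0 <= factor l s.
Proof.
have ex_ge0 j : 0 <= exposed j s by rewrite /exposed; case: ifP => _; rewrite ?ltW.
rewrite /factor; apply: mulr_ge0; first by case: ifP => _ //; rewrite ler0n.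
case: ifP => _ //; do !apply: mulr_ge0 => //.
  exact: link_weight_ge0.
by case: ifP => // _; rewrite subr_ge0 ltW// fill_prob_lt1.
Qed.

(** Summing out the free time of a link gives its weight after the step: a shift in
    the sum defining corr, or a single term. *)
Let esum_factor l : (\esum_(s in setT) (factor l s)%:E =
  (link_weight mu0 (b' l) (b' (l + 1)) (t' l) (t' (l + 1)))%:E)%E.
Proof.
have single (v : R) : 0 <= v ->
    (\esum_(s in [set: nat]) ((s == 0%N)%:R * v)%:E = v%:E)%E.
  move=> v0; rewrite -[RHS](@esum_single R nat setT 0%N v%:E)//; apply: eq_esum => s _.
  by case: eqP; rewrite ?mul1r ?mul0r.
have [lA|lA] := boolP (l \in A0).
  rewrite /factor /rigid lA orbT single//.
  have [-> ->] := new_sign lA; have [-> ->] := new_zero lA.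
  by rewrite /link_weight.
rewrite /factor /rigid (negbTE lA) orbF.
have bB : Bset b' by case: yS.
have [tl|tl] := eqVneq (t' l) 0%N; have [tr|tr] := eqVneq (t' (l + 1)) 0%N => /=.
- have bl := old_sign tl lA; have [br _] := new_sign (old_next tr lA).
  rewrite bl br tl tr /link_weight/= -(GE 0 0); apply: eq_esum => s _.
  by rewrite /endpoint /exposed /hole !bpE tl tr bl br /= eqxx !mul1r.
- have bl := old_sign tl lA; have [c tc] : exists c, t' (l + 1) = c.+1.
    by case: (t' (l + 1)) tr => [//|c] _; exists c.
  rewrite bl tl tc.
  transitivity (\esum_(s in setT) (link_weight mu0 (-1) (b' (l + 1)) s c * q s.+1)%:E)%E.
    apply: eq_esum => s _; rewrite /endpoint /exposed /hole !bpE tl tc bl /=.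
    by rewrite mul1r !mulr1.
  have [br|br] := sign_cases (l + 1) bB; rewrite br /link_weight/=.
    rewrite (esum_shift (m := c.+1)); first last.
    + by move=> s sc; rewrite (_ : (s - c)%N = 0%N) ?q0 ?mul0r//; lia.
    + by move=> s; rewrite mulr_ge0.
    rewrite -(GE 0 c.+1); apply: eq_esum => s _; congr (q _ * q _)%:E; lia.
  rewrite subn0 -[RHS](@esum_single R nat setT c) ?lee_fin//; apply: eq_esum => s _.
  by case: eqP => [->|_]; rewrite ?mul1r ?mul0r.
- have [br _] := new_sign (old_next tr lA); have [a ta] : exists a, t' l = a.+1.
    by case: (t' l) tl => [//|a] _; exists a.
  rewrite br tr ta.
  transitivity (\esum_(s in setT) (link_weight mu0 (b' l) 1 a s * q s.+1)%:E)%E.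
    apply: eq_esum => s _; rewrite /endpoint /exposed /hole !bpE tr ta br /=.
    by rewrite opprK andbF !mul1r mulr1.
  have [bl|bl] := sign_cases l bB; rewrite bl /link_weight/=.
    rewrite subn0 -[RHS](@esum_single R nat setT a) ?lee_fin//; apply: eq_esum => s _.
    by rewrite eq_sym; case: eqP => [->|_]; rewrite ?mul1r ?mul0r.
  rewrite (esum_shift (m := a.+1)); first last.
  + by move=> s sa; rewrite (_ : (s - a)%N = 0%N) ?q0 ?mul0r//; lia.
  + by move=> s; rewrite mulr_ge0.
  rewrite -(GE a.+1 0); apply: eq_esum => s _; rewrite mulrC.
  congr (q _ * q _)%:E; lia.
- have [c tc] : exists c, t' (l + 1) = c.+1.
    by case: (t' (l + 1)) tr => [//|c] _; exists c.
  have [a ta] : exists a, t' l = a.+1.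
    by case: (t' l) tl => [//|a] _; exists a.
  rewrite tc ta /endpoint /exposed /hole !bpE tc ta /= mulr1 mulr1.
  rewrite single.
    have [bl|bl] := sign_cases l bB; have [br|br] := sign_cases (l + 1) bB;
      rewrite bl br /link_weight/= ?mulr1 ?subSS ?eqSS//.
    by rewrite fill_probC_corr.
  apply: mulr_ge0.
    exact: link_weight_ge0.
  by case: ifP => // _; rewrite subr_ge0 ltW// fill_prob_lt1.
Qed.

(** The predecessors of y are parametrised by one free time per link, and in this
    parametrisation weight times rate is a product over the links. *)
Lemma esum_weight_kernel :
  (\esum_(x in Btilde L) (link_product mu0 x * fill_kernel mu0 x y)%:E =
   (link_product mu0 y)%:E)%E.
Proof.
pose U := [set u : {ffun Z -> nat} | forall l, rigid l -> u l = 0%N].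
pose e (u : {ffun Z -> nat}) : state := (bp, times u).
have in_U x : (link_product mu0 x * fill_kernel mu0 x y) != 0 ->
    Btilde L x /\ (e @` U) x.
  rewrite fill_kernelE mulf_eq0 negb_or => /andP[Wx].
  rewrite mulf_eq0 negb_or => /andP[_]; rewrite pnatr_eq0 eqb0 negbK.
  rewrite (step_newE yS) => /andP[/eqP xb /forallP xt].
  have bB : Bset x.1 by rewrite xb; exact: pred_sign_Bset.
  have tT : Tset x.1 x.2.
    by apply: contrapT => /(link_product_out bB) W0; rewrite W0 eqxx in Wx.
  split => //; exists [ffun l => if rigid l then 0%N else
      if t' l == 0%N then x.2 l else x.2 (l + 1)].
    by move=> l rl; rewrite ffunE rl.
  rewrite [RHS]surjective_pairing xb; congr pair; apply/ffunP => j; rewrite ffunE.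
  rewrite /endpoint; case: eqP => tj; last first.
    by have := xt j; rewrite -/t'; case: eqP => //= _ /eqP <-.
  case: ifP => jA; rewrite ffunE /rigid.
    have jA1 : j - 1 \notin A0.
      by apply/negP => /(new_cells_next yS); rewrite subrK -/A0 jA.
    rewrite subrK tj eqxx andbF (negbTE jA1)/=; case: eqP => // tj1.
    have [_ _] := tT (j - 1); rewrite subrK; apply.
      by rewrite xb bpE tj1 eqxx (old_sign tj1 jA1).
    by rewrite xb bpE tj eqxx; have [-> _] := new_sign jA.
  by rewrite tj eqxx /= jA.
rewrite (esum_support (B := e @` U)); last first.
  by move=> x; rewrite eqe => /in_U[].
rewrite esum_image; last first.
  move=> u v /[!inE] uU vU [/ffunP uv]; apply/ffunP => l.
  have [rl|] := boolP (rigid l); first by rewrite uU ?vU.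
  rewrite negb_or negb_and !negbK => /andP[tl lA].
  have := uv l; have := uv (l + 1).
  rewrite !times_right// !times_left// /endpoint.
  by case/orP: tl => ->.
have FE u : U u -> (link_product mu0 (e u) * fill_kernel mu0 (e u) y)%:E =
    (\prod_l factor l (u l))%:E.
  by move=> uU; rewrite fill_kernelE step_times mulr1 weight_factor.
rewrite (eq_esum FE) (esum_support (B := setT)); last first.
  move=> u; rewrite eqe => uN0; split => // _ l rl.
  move: uN0 => /prodf_neq0 /(_ l isT); rewrite /factor rl mulf_eq0 negb_or.
  by rewrite pnatr_eq0 eqb0 negbK => /andP[/eqP].
exact: (esum_prod_ffun factor_ge0 esum_factor).
Qed.

End Predecessors.

End Invariance.

(** * Finiteness of the partition function *)

Section Cycle.
Variable L : nat.
Local Notation Z := 'Z_(L.*2).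

Lemma cycle_ind (P : Z -> Prop) (i0 : Z) : P i0 -> (forall i, P i -> P (i + 1)) ->
  forall i, P i.
Proof.
move=> P0 PS i; have -> : i = i0 + (val (i - i0))%:R by rewrite natr_Zp addrC subrK.
by elim: (val _) => [|k IH]; rewrite ?addr0// -natr1 addrA; exact: PS.
Qed.

Lemma big_cycle (V : Type) (idx : V) (op : Monoid.com_law idx) (f : Z -> V) (i0 : Z) :
  \big[op/idx]_i f i = \big[op/idx]_(0 <= k < #|{: Z}|) f (i0 + k%:R).
Proof.
rewrite (reindex_inj (addrI i0)) card_ord big_mkord.
by apply: eq_bigr => i _; rewrite natr_Zp.
Qed.

Lemma exists_hole (b : {ffun Z -> int}) : Bset b -> exists i, hole b i.
Proof.
case=> bB bs; apply: contrapT => /forallNP nh.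
have up i : b i = 1 -> b (i + 1) = 1.
  by move=> bi; case: (bB (i + 1)) => // bi1; case: (nh i); rewrite /hole bi bi1.
have [[i0 bi0]|/forallNP n1] := pselect (exists i, b i = 1).
  move: bs; rewrite (eq_bigr (fun _ => 1)); last first.
    by move=> i _; apply: (cycle_ind bi0 up).
  by rewrite sumr_const card_ord; lia.
move: bs; rewrite (eq_bigr (fun _ => -1)); last first.
  by move=> i _; case: (bB i) => // bi; case: (n1 i).
by rewrite sumr_const card_ord; lia.
Qed.

Lemma finite_Bset : finite_set (@Bset L).
Proof.
pose e (c : {ffun Z -> bool}) : {ffun Z -> int} := [ffun i => if c i then 1 else -1].
apply: (@sub_finite_set _ _ (e @` setT)); last exact: finite_image.
move=> b [bB _]; exists [ffun i => b i == 1] => //; apply/ffunP => i; rewrite !ffunE.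
by case: (bB i) => ->.
Qed.

(** The bound is reached by going once round the cycle, starting just after the
    link i0, whose variation d i0 bounds the first value. *)
Lemma le_cycle_variation (t : Z -> nat) (d : Z -> nat) (i0 : Z) :
  (t (i0 + 1)%R <= d i0)%N -> (forall i : Z, i != i0 -> t (i + 1)%R <= t i + d i)%N ->
  forall j, (t j <= \sum_i d i)%N.
Proof.
move=> h0 h j; rewrite (big_cycle _ _ i0).
have -> : j = i0 + 1 + (val (j - (i0 + 1)))%:R by rewrite natr_Zp addrC subrK.
rewrite card_ord; set k := val _; have kn : (k < (Zp_trunc L.*2).+2)%N by exact: ltn_ord.
apply: (@leq_trans (\sum_(0 <= m < k.+1) d (i0 + m%:R)%R)%N); last first.
  by rewrite (big_cat_nat (n := k.+1) (p := _.+2))//= leq_addr.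
clearbody k; elim: k kn => [|k IH] kn; first by rewrite big_nat1 !addr0.
rewrite big_nat_recr//=.
have -> : i0 + 1 + k.+1%:R = i0 + 1 + k%:R + 1 by rewrite -natr1 addrA.
have E : i0 + 1 + k%:R = i0 + k.+1%:R by rewrite -natr1 -addrA [1 + _]addrC.
apply: leq_trans (h _ _) _.
  rewrite E; apply/eqP => /(congr1 (fun z => z - i0)).
  rewrite addrC addKr subrr Zp_nat => /(congr1 val)/=.
  by rewrite modn_small.
by rewrite -E leq_add2r IH// ltnW.
Qed.


End Cycle.

Section Finite.
Variables (R : realType) (mu0 : nat -> R) (alpha : R).
Hypotheses (hmu0 : full_support_law mu0) (halpha : 0 < alpha)
  (hinf : alpha <= hazard_inf mu0).
Variable L : nat.
Local Notation Z := 'Z_(L.*2).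
Local Notation state := ({ffun Z -> int} * {ffun Z -> nat})%type.
Local Notation n := #|{: Z}|.

Lemma link_weight_geometric : exists b : R, exists2 K : R, 0 < b < 1 /\ 1 <= K &
  forall (e e' : int) a c, [/\ link_weight mu0 e e' a c <= K * b ^+ absdiff a c &
    corr mu0 a c <= K * b ^+ (a + c)].
Proof.
have [b1 [K1 [b1_01 K1_gt0] qK]] := sqrt_law_geometric hmu0 halpha hinf.
have [b2 [K2 b2_01 GK]] := corr_geometric hmu0 halpha hinf.
pose b := Num.max b1 b2; pose K := 1 + K1 + Num.max 0 K2.
have b01 : 0 < b < 1.
  by rewrite lt_max gt_max; case/andP: b1_01 => -> ->; case/andP: b2_01 => _ ->.
have K2m : K2 <= Num.max 0 K2 by rewrite le_max lexx orbT.
have K2p : 0 <= Num.max 0 K2 by rewrite le_max lexx.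
have bnd (k c m : R) (s : nat) : 0 <= c <= b -> k <= K -> m <= k * c ^+ s -> m <= K * b ^+ s.
  move=> /andP[c0 cb] kK mk; apply: (le_trans mk).
  apply: (@le_trans _ _ (K * c ^+ s)); first by rewrite ler_wpM2r// exprn_ge0.
  by rewrite ler_wpM2l ?lerXn2r// ?nnegrE ?(le_trans c0)// /K; lra.
have Gb a c : corr mu0 a c <= K * b ^+ (a + c).
  apply: (bnd _ _ _ _ _ _ (GK a c)); last by rewrite /K; lra.
  by rewrite le_max lexx orbT andbT ltW//; case/andP: b2_01.
have qb s : sqrt_law mu0 s <= K * b ^+ s.
  apply: (bnd _ _ _ _ _ _ (qK s)); last by rewrite /K; lra.
  by rewrite le_max lexx andbT ltW//; case/andP: b1_01.
have K_ge1 : 1 <= K by rewrite /K; lra.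
have K_ge0 : 0 <= K by apply: le_trans K_ge1.
have Kb s : 0 <= K * b ^+ s.
  by apply: mulr_ge0 => //; apply: exprn_ge0; case/andP: b01 => /ltW.
exists b; exists K => // e e' a c; split => //.
have q_sub x y : sqrt_law mu0 (x - y) <= K * b ^+ absdiff y x.
  have [xy|yx] := leqP x y.
    by rewrite (_ : (x - y)%N = 0%N) ?(sqrt_law0 hmu0)//; apply/eqP; rewrite subn_eq0.
  by rewrite absdiffE// ltnW.
rewrite /link_weight; case: ifP => _; case: ifP => _ //; last first.
- by rewrite absdiffC.
- have [->|_] := eqVneq a c; last by [].
  by rewrite /absdiff subrr absz0 expr0 mulr1.
- apply: le_trans (Gb a c) _; rewrite ler_wpM2l//.
  apply: ler_wiXn2l; [by case/andP: b01 => /ltW|by case/andP: b01 => _ /ltW|].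
  exact: absdiff_leD.
Qed.

(** The variations of the times along the links, together with the times at one
    hole, control all times; the weight decays geometrically in these quantities. *)
Lemma link_product_geometric : exists g : R, exists2 C : R, 0 < g < 1 /\ 0 <= C &
  forall x : state, Bset x.1 -> link_product mu0 x <= C * \prod_j g ^+ x.2 j.
Proof.
have [b [K [b01 K1] bnd]] := link_weight_geometric.
have K0 : 0 <= K by rewrite (le_trans ler01).
have [b0 b1] := andP b01.
have n0 : (0 < n)%N by rewrite card_ord.
(* By Bernoulli's inequality b <= g ^+ n, which spreads the decay over n times. *)
pose g := 1 - (1 - b) / n%:R.
have u01 : 0 <= (1 - b) / n%:R <= 1.
  rewrite divr_ge0 ?subr_ge0 ?ler0n ?(ltW b1)//= ler_pdivrMr ?ltr0n// mul1r.
  by apply: (@le_trans _ _ 1); rewrite ?ler1n// lerBlDr lerDl ltW.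
have gb : b <= g ^+ n.
  apply: le_trans (bernoulli_le n u01); rewrite mulrC divfK ?subKr//.
  by rewrite pnatr_eq0 -lt0n.
have g1 : g < 1 by rewrite /g gtrBl divr_gt0 ?ltr0n// subr_gt0.
have g0 : 0 < g.
  rewrite lt_neqAle /g subr_ge0; case/andP: (u01) => _ ->; rewrite andbT eq_sym.
  apply/eqP => g0; move: gb; rewrite /g g0 expr0n -leqn0 leqNgt n0/= leNgt.
  by rewrite b0.
exists g; exists (K ^+ n); first by rewrite g0 g1 exprn_ge0.
move=> x bB; have [i0 hi0] := exists_hole bB.
(* At the hole i0 the weight decays in the sum of both times, not only in their
   difference: this anchors the times. *)
pose d i := if i == i0 then (x.2 i + x.2 (i + 1)%R)%N
  else absdiff (x.2 i) (x.2 (i + 1)%R).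
apply: (@le_trans _ _ (\prod_i (K * b ^+ d i))).
  rewrite /link_product; apply: ler_prod => i _; apply/andP; split.
    by exact: (link_weight_ge0 hmu0 halpha hinf).
  have [H1 H2] := bnd (x.1 i) (x.1 (i + 1)) (x.2 i) (x.2 (i + 1)).
  rewrite /d; case: eqP => // ii0; move: hi0; rewrite -ii0 => /andP[/eqP e /eqP e'].
  by rewrite e e' /link_weight.
rewrite big_split/= prodr_const ler_pM2l ?exprn_gt0 ?(lt_le_trans ltr01)//.
rewrite !prodrXr; pose D := (\sum_i d i)%N.
have tD j : (x.2 j <= D)%N.
  apply: (@le_cycle_variation L x.2 d i0) => [|i ii0].
    by rewrite /d eqxx leq_addl.
  by rewrite /d (negbTE ii0) leq_absdiff.
apply: (@le_trans _ _ (g ^+ (n * D))).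
  rewrite exprM; apply: lerXn2r => //; rewrite nnegrE ?exprn_ge0// ltW//.
apply: ler_wiXn2l; rewrite ?(ltW g0) ?(ltW g1)//.
by rewrite -sum_nat_const; apply: leq_sum => j _.
Qed.

Lemma link_product_gt0 x : Btilde L x -> 0 < link_product mu0 x.
Proof.
case=> bB tT; apply: prodr_gt0 => i _; rewrite /link_weight; have [h1 h2 h3] := tT i.
have q_sub_gt0 a c : (a < c)%N -> 0 < sqrt_law mu0 (c - a).
  by move=> ac; rewrite -(prednK (n := c - a)) ?subn_gt0//;
    exact: (sqrt_law_gt0 hmu0 halpha hinf).
have [e|e] := sign_cases i bB; have [e'|e'] := sign_cases (i + 1) bB; rewrite e e' /=.
- exact/q_sub_gt0/h2.
- by rewrite h3// eqxx.
- exact: (corr_gt0 hmu0 halpha hinf).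
- exact/q_sub_gt0/h1.
Qed.

Lemma partition_functionE : partition_function mu0 L =
  (\esum_(x in Btilde L) (link_product mu0 x)%:E)%E.
Proof.
rewrite /partition_function esum_esum; last first.
  move=> b t bB tT; rewrite lee_fin (weightE hmu0 halpha hinf (x := (b, t)))//.
  exact: (link_product_ge0 hmu0 halpha hinf).
by apply: eq_esum => x xS; rewrite (weightE hmu0 halpha hinf).
Qed.

Lemma partition_function_lty : (partition_function mu0 L < +oo)%E.
Proof.
have [g [C [g01 C0] WC]] := link_product_geometric.
have [g0 g1] := andP g01.
pose v : R := fine (\esum_(s in [set: nat]) (g ^+ s)%:E)%E.
have gs0 s : 0 <= g ^+ s by rewrite exprn_ge0 // ltW.
have vE : (\esum_(s in [set: nat]) (g ^+ s)%:E = v%:E)%E.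
  apply: esum_fineK => //; apply: le_lt_trans (ltry (1 * (1 - g)^-1)).
  by apply: esum_geometric_le => // s; rewrite mul1r.
apply: (@le_lt_trans _ _ (\esum_(b in @Bset L) (C * v ^+ n)%:E)%E).
  apply: le_esum => b bB.
  have -> : ((C * v ^+ n)%:E = C%:E * (\prod_(j : Z) v)%:E)%E by rewrite prodr_const.
  rewrite -(@esum_prod_ffun R _ (fun (_ : Z) s => g ^+ s) (fun=> v))//.
  rewrite -esumZ//; last by move=> u; exact: prodr_ge0.
  apply: (@le_trans _ _ (\esum_(t in Tset b) (C * \prod_j g ^+ t j)%:E)%E).
    apply: le_esum => t tT; rewrite lee_fin (weightE hmu0 halpha hinf (x := (b, t)))//.
    exact: WC.
  exact: subset_esum.
rewrite esum_fset; [|exact: finite_Bset|]; last first.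
  move=> b _; rewrite lee_fin mulr_ge0// exprn_ge0// fine_ge0//.
  by apply: esum_ge0 => s _; rewrite lee_fin.
by rewrite (fsbig_finite _ _ (@finite_Bset L))/= sumEFin ltry.
Qed.

End Finite.

(** * Deterministic tables and the heights of their fronts *)

Section Tables.
Variables (L : nat) (hL : (0 < L)%N).
Local Notation Z := 'Z_(L.*2).
Local Notation state := ({ffun Z -> int} * {ffun Z -> nat})%type.
Implicit Types (a : Z -> nat -> nat) (i j x : Z) (y n h : nat) (A : {set Z}).

Let card_Z : (Zp_trunc L.*2).+2 = L.*2.
Proof. by rewrite Zp_cast// -addnn; lia. Qed.

Lemma is_cell_next i y : is_cell (i + 1) y = ~~ is_cell i y.
Proof.
rewrite /is_cell !oddD; congr (~~ _); suff -> : odd (i + 1)%R = ~~ odd i.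
  by case: (odd i) (odd y) => [] [].
have -> : (i + 1)%R = ((i.+1) %% L.*2)%N :> nat.
  by rewrite /= modnDmr addn1; congr (_ %% _)%N; exact: card_Z.
have iL : (i < L.*2)%N.
  by have := ltn_ord i; rewrite [X in (_ < X)%N -> _]card_Z.
move: iL; rewrite leq_eqVlt => /predU1P[iE|iL].
  by rewrite iE modnn -[odd i]negbK -oddS iE odd_double.
by rewrite modn_small// oddS.
Qed.

Lemma is_cell_prev i y : is_cell (i - 1) y = ~~ is_cell i y.
Proof. by rewrite -[in RHS](subrK 1 i) is_cell_next negbK. Qed.

Lemma is_cellS i y : is_cell i y.+1 = ~~ is_cell i y.
Proof. by rewrite /is_cell addnS oddS. Qed.

Definition valid_table a : Prop :=
  (forall x, is_cell x 0 -> a x 0%N = 0%N) /\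
  forall x y, is_cell x y.+1 ->
    (maxn (a (x - 1)%R y) (a (x + 1)%R y) < a x y.+1)%N.

Definition front a n : state := Ftilde (fun x y (_ : unit) => a x y) n tt.

Definition front_height a n i : nat := height (fun x y (_ : unit) => a x y) n i tt.

(** The value at the cell that the column i, a zigzag of two adjacent vertical
    lines, has in row y. *)
Definition column_val a i y : nat := a (column i y) y.

Lemma column_val_cell a i y : is_cell i y -> column_val a i y = a i y.
Proof. by rewrite /column_val /column => ->. Qed.

Lemma column_val_prev a i y : ~~ is_cell i y -> column_val a i y = a (i - 1) y.
Proof. by rewrite /column_val /column => /negbTE ->. Qed.

Lemma column_val_next a i y : is_cell i y -> column_val a (i + 1) y = a i y.
Proof. by move=> c; rewrite column_val_prev ?addrK// is_cell_next c. Qed.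

Section Valid.
Variables (a : Z -> nat -> nat).
Hypothesis va : valid_table a.

Lemma column_val_lt i y : (column_val a i y < column_val a i y.+1)%N.
Proof.
have [c|c] := boolP (is_cell i y).
- rewrite column_val_cell// column_val_prev ?is_cellS ?c//.
  have := va.2 (i - 1) y; rewrite is_cellS is_cell_prev negbK subrK => /(_ c).
  by rewrite gtn_max => /andP[].
- rewrite column_val_prev// column_val_cell ?is_cellS ?c//.
  have := va.2 i y; rewrite is_cellS => /(_ c).
  by rewrite gtn_max => /andP[].
Qed.

Lemma column_val_homo i y h : (y <= h)%N -> (column_val a i y <= column_val a i h)%N.
Proof.
move=> /subnK <-; elim: (h - y)%N => [//|k IH]; rewrite addSn.
by apply: leq_trans IH _; rewrite ltnW// column_val_lt.
Qed.

Lemma column_val_ge i y : (y <= column_val a i y)%N.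
Proof. by elim: y => [//|y IH]; apply: leq_ltn_trans IH (column_val_lt _ _). Qed.

Lemma column_val0 i : column_val a i 0 = 0%N.
Proof.
have [c|c] := boolP (is_cell i 0); first by rewrite column_val_cell// va.1.
by rewrite column_val_prev// va.1// is_cell_prev.
Qed.

Lemma le_front_height n i h : (h <= front_height a n i)%N = (column_val a i h <= n)%N.
Proof.
have ex : exists h, (column_val a i h <= n)%N by exists 0%N; rewrite column_val0.
have ub k : (column_val a i k <= n)%N -> (k <= n)%N.
  by move/(leq_trans (column_val_ge i k)).
case: (ex_maxnP ex ub) => m m1 m2.
suff -> : front_height a n i = m.
  apply/idP/idP => [hm|/m2//]; apply: leq_trans m1; exact: column_val_homo.
rewrite /front_height /height; case: xgetP => [k _ [k1 k2]|/(_ m)].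
  by apply/eqP; rewrite eqn_leq m2//= k2.
by case; split => // k /m2.
Qed.

Lemma front_height_le n i : (front_height a n i <= n)%N.
Proof.
have := le_front_height n i (front_height a n i); rewrite leqnn => /esym.
exact/leq_trans/column_val_ge.
Qed.

Lemma column_val_height n i : (column_val a i (front_height a n i) <= n)%N.
Proof. by rewrite -le_front_height. Qed.

Lemma column_val_heightS n i : (n < column_val a i (front_height a n i).+1)%N.
Proof. by rewrite ltnNge -le_front_height ltnn. Qed.

Lemma front_heightP n i h : (column_val a i h <= n)%N -> (n < column_val a i h.+1)%N ->
  front_height a n i = h.
Proof.
rewrite -le_front_height => h1; rewrite ltnNge -le_front_height -ltnNge ltnS => h2.
by apply/eqP; rewrite eqn_leq h2.
Qed.

Lemma front_sign n i : (front a n).1 i = if is_cell i (front_height a n i) then -1 else 1.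
Proof.
rewrite ffunE -/(front_height a n i) /column.
case: (is_cell i _); first by rewrite eqxx.
by rewrite -subr_eq0 addrAC subrr add0r oppr_eq0 oner_eq0.
Qed.

Lemma front_time n i :
  (front a n).2 i = (n - column_val a i (front_height a n i))%N.
Proof. by rewrite ffunE. Qed.

Section Next.
Variables (n : nat) (i : Z).
Local Notation H := (front_height a n).

(** The columns i and i + 1 share their cells in every other row, which leaves two
    possible heights for column i + 1, told apart by the signs. *)
Lemma height_next : (H (i + 1)%R + ~~ is_cell i (H i) + ~~ is_cell (i + 1)%R (H (i + 1)%R) =
  (H i).+1)%N.
Proof.
have same y : is_cell i y -> (y <= H i)%N = (y <= H (i + 1)%R)%N.
  by move=> c; rewrite !le_front_height column_val_cell// column_val_next.
rewrite is_cell_next negbK.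
have [c|c] := boolP (is_cell i (H i)); rewrite /= ?addn0 ?addn1.
  have := same _ c; rewrite leqnn => /esym h1.
  have := same (H i).+2; rewrite !is_cellS negbK c => /(_ isT).
  rewrite leqNgt ltnS leqnSn/= => /esym/negbT; rewrite -ltnNge ltnS => h2.
  move: h1; rewrite leq_eqVlt => /predU1P[<-|h1]; first by rewrite c addn1.
  have -> : H (i + 1)%R = (H i).+1 by apply/eqP; rewrite eqn_leq h1 h2.
  by rewrite is_cellS c addn0.
have := same (H i).+1; rewrite is_cellS => /(_ c); rewrite ltnn => /esym/negbT.
rewrite -leqNgt => h1.
case E : (H i) c h1 same => [|k] c h1 same.
  by move: h1; rewrite leqn0 => /eqP ->; rewrite (negbTE c).
have := same k; move: (c); rewrite is_cellS negbK => ck /(_ ck); rewrite leqnSn => /esym h2.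
move: h1; rewrite leq_eqVlt ltnS => /predU1P[->|h1]; first by rewrite (negbTE c) addn0.
have -> : H (i + 1)%R = k by apply/eqP; rewrite eqn_leq h1 h2.
by rewrite ck addn1.
Qed.

End Next.
End Valid.
End Tables.

(** * The motion of the front *)

Section Dynamics.
Variables (L : nat) (hL : (0 < L)%N).
Local Notation Z := 'Z_(L.*2).
Local Notation state := ({ffun Z -> int} * {ffun Z -> nat})%type.
Implicit Types (a : Z -> nat -> nat) (i j x : Z) (y n h : nat) (A : {set Z}).

Section Valid.
Variables (a : Z -> nat -> nat).
Hypothesis va : valid_table a.
Local Notation H := (front_height a).

(** By height_next, b_i + b_(i+1) is twice the drop of the height from i to i + 1,
    so the signs sum to 0 round the cycle; the constraints on the times say that a
    cell comes after its parents. *)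
Lemma front_Btilde n : Btilde L (front a n).
Proof.
have next i := height_next hL va n i.
split; [split => [i|]|].
- by rewrite front_sign; case: ifP; [left|right].
- pose s i : int := (front a n).1 i.
  have sE i : s i + s (i + 1) = 2 * ((H n i)%:Z - (H n (i + 1))%:Z).
    have := next i; rewrite /s !front_sign.
    by case: (is_cell i _); case: (is_cell (i + 1) _) => /= E; lia.
  have : \sum_i (s i + s (i + 1)) = 2 * \sum_i s i.
    rewrite big_split/= [X in _ + X](_ : _ = \sum_i s i); first by ring.
    by rewrite [RHS](reindex_inj (addIr 1)).
  under eq_bigr do rewrite sE.
  rewrite -mulr_sumr sumrB [X in _ - X](_ : _ = \sum_i (H n i)%:Z); last first.
    by rewrite [RHS](reindex_inj (addIr 1)).
  by rewrite subrr mulr0 => /esym/eqP; rewrite mulf_eq0 => /orP[//|/eqP].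
- move=> i; rewrite !front_sign !front_time; have := next i.
  have [c|c] := boolP (is_cell i (H n i));
    have [c'|c'] := boolP (is_cell (i + 1) (H n (i + 1))) => /= E; split => // _ _.
  + have Hi : H n (i + 1) = (H n i).+1 by lia.
    have := column_val_lt hL va (i + 1) (H n i); rewrite column_val_next// -Hi.
    have := column_val_height hL va n (i + 1); have := column_val_cell a c; lia.
  + have Hi : H n (i + 1) = H n i by lia.
    by rewrite Hi column_val_next// column_val_cell.
  + have Hi : H n i = (H n (i + 1)).+1 by lia.
    move: c'; rewrite is_cell_next// negbK => c'.
    have := column_val_lt hL va i (H n (i + 1)); rewrite -Hi.
    rewrite (column_val_next hL _ c') (column_val_cell a c').
    have := column_val_height hL va n i; lia.
Qed.

(** The cell that fills the hole at i sits in column i, just above the front. *)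
Definition filling n : {set Z} :=
  [set i | hole (front a n).1 i && (a i (H n i).+1 == n.+1)].

Lemma hole_front n i : hole (front a n).1 i =
  ~~ is_cell i (H n i) && is_cell (i + 1) (H n (i + 1)).
Proof.
by rewrite /hole !front_sign; case: (is_cell i _); case: (is_cell (i + 1) _).
Qed.

Lemma hole_heights n i : hole (front a n).1 i ->
  [/\ ~~ is_cell i (H n i), H n (i + 1) = H n i,
      a (i - 1) (H n i) = column_val a i (H n i),
      a (i + 1) (H n i) = column_val a (i + 1) (H n (i + 1)) &
      column_val a i (H n i).+1 = a i (H n i).+1].
Proof.
rewrite hole_front => /andP[c c']; have := height_next hL va n i.
rewrite c c' /= addn0 addn1 => -[E]; rewrite E; split => //.
- by rewrite column_val_prev.
- by rewrite column_val_cell// -E.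
- by rewrite column_val_cell// is_cellS.
Qed.

(** A cell added on top of column j has its two parents in the front, which forces
    a hole at j or at j - 1. *)
Lemma filled_filling n j :
  filled (filling n) j = (column_val a j (H n j).+1 == n.+1).
Proof.
apply/idP/idP => [/(@filled_hole _ (front a n).1)|/eqP E].
  case=> [i|[]|[]]; first by rewrite inE => /andP[].
    by rewrite inE => /andP[/hole_heights[_ _ _ _ ->]].
  rewrite inE => /andP[/hole_heights[c Hj _ _ _] E] _.
  rewrite subrK in Hj; rewrite Hj column_val_prev// is_cellS.
  by move: c; rewrite is_cell_prev.
have [c|c] := boolP (is_cell j (H n j)).
- apply/orP; right; rewrite inE hole_front subrK c andbT.
  have := height_next hL va n (j - 1); rewrite subrK c addn0 => N.
  have lej : (H n j <= H n (j - 1)%R)%N.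
    rewrite le_front_height// column_val_prev ?is_cell_prev ?c//.
    have := va.2 (j - 1) (H n j); rewrite is_cellS is_cell_prev// negbK => /(_ c).
    rewrite column_val_prev ?is_cellS ?c// in E; rewrite E gtn_max ltnS.
    by case/andP.
  move: N; case: (is_cell (j - 1) _) => /= N; first by lia.
  have -> : H n (j - 1) = H n j by lia.
  by rewrite -E column_val_prev ?eqxx ?is_cellS ?c.
- apply/orP; left; rewrite inE hole_front c /=.
  have := height_next hL va n j; rewrite c => N.
  have lej : (H n j <= H n (j + 1)%R)%N.
    rewrite le_front_height// column_val_cell ?is_cell_next//.
    have := va.2 j (H n j); rewrite is_cellS => /(_ c).
    by rewrite column_val_cell ?is_cellS// in E; rewrite E gtn_max ltnS => /andP[].
  move: N; case: (is_cell (j + 1) _) => /= N; last by lia.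
  by rewrite -E column_val_cell ?eqxx ?is_cellS.
Qed.

Lemma front_heightS n j : H n.+1 j = (H n j + filled (filling n) j)%N.
Proof.
have h1 := column_val_height hL va n j.
have h2 := column_val_heightS hL va n j.
have h3 := column_val_lt hL va j (H n j).+1.
by apply: front_heightP => //; rewrite filled_filling; case: eqP => E;
  rewrite ?addn1 ?addn0; lia.
Qed.

Lemma front_step n : front a n.+1 = step (front a n) (filling n).
Proof.
rewrite [LHS]surjective_pairing; congr pair; apply/ffunP => j;
  rewrite [RHS]ffunE ?front_sign// ?front_time front_heightS.
  by case: (filled _ j); rewrite ?addn1 ?addn0 ?is_cellS//; case: (is_cell j _);
    rewrite ?opprK.
have h1 := column_val_height hL va n j.
have := filled_filling n j; case: (filled _ j) => /esym; rewrite ?addn1 ?addn0.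
  by move/eqP ->; rewrite subnn.
by move=> _; rewrite subSn.
Qed.

Lemma front_height0 i : H 0 i = 0%N.
Proof. by apply/eqP; rewrite -leqn0 front_height_le. Qed.

Lemma front_height_times n j :
  H n.+1 j = (H n j + ((front a n.+1).2 j == 0%N))%N.
Proof. by rewrite front_heightS front_step ffunE; case: (filled _ j). Qed.

End Valid.

(** Two tables that cannot be told apart by time n. *)
Definition same_until n a a' : Prop :=
  forall x y, is_cell x y -> minn (a x y) n.+1 = minn (a' x y) n.+1.

Lemma is_cell_column i y : is_cell (column i y) y.
Proof. by rewrite /column; case: ifP => // /negbT c; rewrite is_cell_prev. Qed.

Lemma same_until_leq n a a' i h k : same_until n a a' -> (k <= n)%N ->
  (column_val a i h <= k)%N = (column_val a' i h <= k)%N.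
Proof.
by move=> /(_ _ _ (is_cell_column i h)) E kn; rewrite /column_val; lia.
Qed.

Lemma same_until_front n a a' k : valid_table a -> valid_table a' ->
  same_until n a a' -> (k <= n)%N ->
  front a k = front a' k /\ front_height a k =1 front_height a' k.
Proof.
move=> va va' E kn.
have EH : front_height a k =1 front_height a' k.
  move=> i; apply: front_heightP => //.
    by rewrite (same_until_leq _ _ E kn) column_val_height.
  by rewrite ltnNge (same_until_leq _ _ E kn) -ltnNge column_val_heightS.
split => //; rewrite [LHS]surjective_pairing [RHS]surjective_pairing.
congr pair; apply/ffunP => i; first by rewrite !front_sign// EH.
have := E _ _ (is_cell_column i (front_height a' k i)).
have := column_val_height hL va k i; have := column_val_height hL va' k i.
by rewrite !front_time EH /column_val; lia.
Qed.

(** The front alone determines the table: a column grows exactly when its time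
   coordinate is reset. *)
Lemma front_same_until n a a' : valid_table a -> valid_table a' ->
  (forall k, (k <= n)%N -> front a k = front a' k) -> same_until n a a'.
Proof.
move=> va va' E.
have EH k : (k <= n)%N -> front_height a k =1 front_height a' k.
  elim: k => [|k IH] kn i; first by rewrite !front_height0.
  by rewrite !front_height_times// IH ?E// ltnW.
move=> x y c; have le k : (k <= n)%N -> (a x y <= k)%N = (a' x y <= k)%N.
  by move=> kn; rewrite -(column_val_cell a c) -(column_val_cell a' c) -!le_front_height// EH.
have := le n (leqnn n); have [an|an] := leqP (a x y) n => /esym an'.
  have := le (a x y) an; rewrite leqnn => /esym a1.
  by have := le (a' x y) an'; rewrite leqnn; lia.
by move: an' => /negbT; rewrite -ltnNge; lia.
Qed.

(** The cells of the chosen holes get the value n + 1, and the other cells beyond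
    the front get n + 1 plus their row, which is later than that of any parent. *)
Lemma extend_table n a A : valid_table a ->
  (forall i, i \in A -> hole (front a n).1 i) ->
  exists a', [/\ valid_table a', same_until n a a' & filling a' n = A].
Proof.
move=> va Ah; pose H := front_height a n.
pose a' x y := if (a x y <= n)%N then a x y else
  if (x \in A) && (y == (H x).+1) then n.+1 else (n.+1 + y)%N.
have a'_le x y : (a' x y <= n.+1 + y)%N.
  by rewrite /a'; case: ifP => [|_]; [|case: ifP => _]; lia.
have va' : valid_table a'.
  split => [x c|x y c]; first by rewrite /a' va.1.
  have := va.2 _ _ c; rewrite !gtn_max => /andP[l1 l2].
  rewrite {2 4}/a'; case: ifP => [an|_].
    have n1 : (a (x - 1)%R y <= n)%N by lia.
    have n2 : (a (x + 1)%R y <= n)%N by lia.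
    by rewrite /a' n1 n2 l1 l2.
  case: ifP => [/andP[xA /eqP[yE]]|_]; last first.
    by have := a'_le (x - 1) y; have := a'_le (x + 1) y; lia.
  have [_ Hx e1 e2 _] := hole_heights va (Ah _ xA).
  have := column_val_height hL va n x; have := column_val_height hL va n (x + 1).
  by rewrite -e1 -e2 yE /a' => -> ->; rewrite !ltnS ?e1 ?e2 !column_val_height.
have sa : same_until n a a'.
  by move=> x y _; rewrite /a'; case: ifP => //; case: ifP => _; lia.
exists a'; split => //; apply/setP => i; rewrite inE.
have [<- EH] := same_until_front va va' sa (leqnn n).
apply/andP/idP => [[hi]|iA].
  have [_ _ _ _ e] := hole_heights va hi.
  have := column_val_heightS hL va n i; rewrite e /a' -EH -/H ltnNge => /negbTE ->.
  by rewrite eqxx andbT; case: ifP => // _ /eqP; lia.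
split; first exact: Ah.
have [_ _ _ _ e] := hole_heights va (Ah _ iA).
have := column_val_heightS hL va n i; rewrite e /a' -EH -/H ltnNge => /negbTE ->.
by rewrite iA eqxx.
Qed.

(** The cells that are missing at time n appear at time n + y, where y is their row,
    so that the rows are completed one after the other. *)
Lemma flatten_table n a : valid_table a ->
  exists a' m, [/\ valid_table a', same_until n a a', (n <= m)%N &
    front a' m = front a' 0].
Proof.
move=> va; pose a' x y := if (a x y <= n)%N then a x y else (n + y)%N.
have va' : valid_table a'.
  split => [x c|x y c]; first by rewrite /a' va.1.
  have := va.2 _ _ c; rewrite !gtn_max => /andP[l1 l2].
  rewrite /a'; case: (leqP (a x y.+1) n) => ?; case: (leqP (a (x - 1)%R y) n) => ?;
    case: (leqP (a (x + 1)%R y) n) => ?; lia.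
(* The row n.+1.*2 is above the front at time n, and even, so that a flat front
   there has the signs of the initial front. *)
exists a', (n + n.+1.*2)%N; split => //; last first.
- set m := n.+1.*2; have nm : (n < m)%N by rewrite /m; lia.
  have high i y : (n < y)%N -> column_val a' i y = (n + y)%N.
    move=> ny; have := column_val_ge hL va i y; rewrite /column_val /a' => yle.
    by rewrite leqNgt (leq_trans ny yle).
  have EH i : front_height a' (n + m) i = m.
    have nm1 : (n < m.+1)%N by exact: leqW.
    by apply: front_heightP => //; rewrite high// addnS.
  rewrite [LHS]surjective_pairing [RHS]surjective_pairing.
  congr pair; apply/ffunP => i; rewrite ?front_sign// ?front_time EH.
    by rewrite front_height0// /is_cell addn0 oddD /m odd_double addbF.
  by rewrite high// subnn sub0n.
- by rewrite leq_addr.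
- move=> x [|y] c; first by rewrite /a' va.1.
  by rewrite /a'; case: ifP => //; case: (leqP (a x y.+1) n) => // ? _; lia.
Qed.

End Dynamics.

(** * Every state is the front of some table *)

Section Realize.
Variables (L : nat) (hL : (0 < L)%N).
Local Notation Z := 'Z_(L.*2).
Local Notation state := ({ffun Z -> int} * {ffun Z -> nat})%type.
Implicit Types (i j x : Z) (y n h : nat).

Lemma val_next i : ((i + 1)%R = i.+1 :> nat /\ (i.+1 < L.*2)%N) \/
  (i.+1 = L.*2 /\ (i + 1)%R = 0 :> Z).
Proof.
have card_Z : (Zp_trunc L.*2).+2 = L.*2 by rewrite Zp_cast// -addnn; lia.
have vE : (i + 1)%R = (i.+1 %% L.*2)%N :> nat.
  by rewrite /= modnDmr addn1; congr (_ %% _)%N; exact: card_Z.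
have iL : (i < L.*2)%N.
  by have := ltn_ord i; rewrite [X in (_ < X)%N -> _]card_Z.
move: iL; rewrite leq_eqVlt => /predU1P[iE|iL]; last by left; rewrite vE modn_small.
by right; split => //; apply: val_inj; rewrite [LHS]vE iE modnn.
Qed.

(** Heights with prescribed slopes: the partial sums of b close up round the
   cycle because b sums to 0. *)
Lemma exists_heights (b : {ffun Z -> int}) : Bset b -> exists h : Z -> nat, forall i,
  [/\ (0 < h i)%N, is_cell i (h i) = (b i == -1) &
    (h (i + 1)%R + (b i != -1)%R + (b (i + 1) != -1)%R = (h i).+1)%N].
Proof.
case=> bB bs; pose m (k : nat) := (\sum_(j : Z | (j < k)%N) (b j == -1)%R)%N.
have m0 : m 0%N = 0%N by rewrite /m big_pred0.
have mS i : m i.+1 = (m i + (b i == -1)%R)%N.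
  rewrite /m (bigD1 i)//= addnC; congr addn; apply: eq_bigl => j.
  by rewrite ltnS ltn_neqAle andbC.
have card_Z : (Zp_trunc L.*2).+2 = L.*2 by rewrite Zp_cast// -addnn; lia.
have iL i : (i < L.*2)%N.
  by have := ltn_ord i; rewrite [X in (_ < X)%N -> _]card_Z.
have mL : m L.*2 = L.
  have : \sum_j b j = \sum_(j : Z) (1 - 2 * (b j == -1)%:R).
    by apply: eq_bigr => j _; case: (bB j) => ->.
  rewrite bs sumrB sumr_const -mulr_sumr -natr_sum card_ord [X in _ *+ X]card_Z.
  have -> : (\sum_(j : Z) (b j == -1)%R)%N = m L.*2.
    by apply: eq_bigl => j; rewrite iL.
  by rewrite !natz; lia.
(* (m i).*2 - i is minus the sum of b over the positions before i; adding the even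
   constant L.*2 + L.*2 makes the height positive without changing its parity. *)
exists (fun i => ((L.*2 - i) + (m i).*2 + L.*2 - (b i == 1)%R)%N) => i.
have b1 j : (b j == 1) = ~~ (b j == -1) by case: (bB j) => ->.
rewrite !b1; split.
- by have := iL i; lia.
- rewrite /is_cell; have := iL i; case: (b i == -1) => /= iL2.
    rewrite subn0 (_ : (i + _)%N = ((m i) + L.*2).*2); last by lia.
    by rewrite odd_double.
  rewrite (_ : (i + _)%N = ((m i) + L.*2).*2.-1); last by lia.
  rewrite -[X in ~~ X]negbK -oddS prednK ?odd_double//.
  by lia.
- have [[-> iL1]|[iE ->]] := val_next i.
    by rewrite mS; have := iL i; case: (b i == -1); case: (b (i + 1) == -1) => /=; lia.
  have := mS i; rewrite iE mL => mLE.
  rewrite m0; have := iL i; case: (b i == -1) mLE; case: (b 0 == -1) => /=; lia.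
Qed.

(** Interior cells get their row as value, front cells the prescribed time, and
   the cells beyond the front a value larger than the current time. *)
Lemma realize_state (x : state) : Btilde L x ->
  exists a n, valid_table a /\ front a n = x.
Proof.
case: x => b t [/= bB tT]; have [h hP] := exists_heights bB.
pose T := (\max_i t i)%N; pose M := (\max_i h i)%N; pose n := (T + M).+1.
have tle i : (t i <= T)%N by exact: (leq_bigmax (F := t)).
have hle i : (h i <= M)%N by exact: (leq_bigmax (F := h)).
pose a i y := if y == h i then (n - t i)%N else
  if y == h (i + 1)%R then (n - t (i + 1)%R)%N else
  if (y < h i)%N then y else (n.+1 + y)%N.
have tP i : [/\ b i != -1 -> b (i + 1) != -1 -> (t i < t (i + 1)%R)%N,
    b i == -1 -> b (i + 1) == -1 -> (t (i + 1)%R < t i)%N &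
    b i == -1 -> b (i + 1) != -1 -> t i = t (i + 1)%R].
  have [t1 t2 t3] := tT i; have e j : (b j != -1) -> b j = 1.
    by case: (bB.1 j) => -> //; rewrite eqxx.
  by split; [move=> /e ? /e ?; exact: t1|move=> /eqP ? /eqP ?; exact: t2|
    move=> /eqP ? /e ?; exact: t3].
have va : valid_table a.
  split => [i c|i y c]; rewrite /a.
    have [h0 h1 h2] := hP i; have [h0' h1' _] := hP (i + 1).
    by rewrite (ltn_eqF h0) (ltn_eqF h0') h0.
  have [_ _ r0] := hP (i - 1); have [h1 c1 r1] := hP i.
  have [_ c2 r2] := hP (i + 1).
  have [t01 t02 t03] := tP (i - 1); have [t11 t12 t13] := tP i.
  have [t21 t22 t23] := tP (i + 1); rewrite subrK in r0 t01 t02 t03 *.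
  have p1 : y.+1 = h i -> b i == -1 by move=> E; rewrite -c1 -E.
  have p2 : y.+1 = h (i + 1) -> b (i + 1) != -1.
    by move=> E; rewrite -c2 -E is_cell_next// c.
  (* What remains is Presburger arithmetic in four consecutive columns. *)
  move: p1 p2 r0 r1 r2 t01 t02 t03 t11 t12 t13 t21 t22 t23.
  move: (tle (i - 1)) (tle i) (tle (i + 1)) (tle (i + 1 + 1)).
  move: (hle (i - 1)) (hle i) (hle (i + 1)) (hle (i + 1 + 1)).
  rewrite /n; move: (h (i - 1)) (h i) h1 (h (i + 1)) (h (i + 1 + 1)) => k0 k1 k1_gt0 k2 k3.
  move: (t (i - 1)) (t i) (t (i + 1)) (t (i + 1 + 1)) => t0 t1 t2 t3.
  move: (b (i - 1) == -1) (b i == -1) (b (i + 1) == -1) (b (i + 1 + 1) == -1).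
  move: (T) (M) => T' M' B0 B1 B2 B3; clear.
  move=> hk0 hk1 hk2 hk3 ht0 ht1 ht2 ht3 p1 p2 r0 r1 r2.
  move=> t01 t02 t03 t11 t12 t13 t21 t22 t23; rewrite gtn_max.
  case: ifP => E1; [|case: ifP => E2; [|case: ifP => E3]];
    apply/andP; split; repeat (case: ifP => ?); lia.
have HE i : front_height a n i = h i.
  have [h1 c1 r1] := hP i; have [_ _] := hP (i - 1); rewrite subrK => r0.
  have [_ _ t3] := tP (i - 1); rewrite subrK in t3.
  apply: front_heightP => //.
    have [c|c] := boolP (is_cell i (h i)).
      by rewrite column_val_cell// /a eqxx leq_subr.
    rewrite column_val_prev// /a subrK eqxx.
    by case: eqP => // _; rewrite leq_subr.
  have [c|c] := boolP (is_cell i (h i)).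
    rewrite column_val_prev ?is_cellS ?c// /a subrK.
    move: r0; rewrite -c1 c; move: (_ == -1) => B.
    by repeat (case: ifP => ?); lia.
  rewrite column_val_cell ?is_cellS// /a.
  move: r1; rewrite -c1 c; move: (_ == -1) => B.
  by repeat (case: ifP => ?); lia.
exists a, n; split => //.
rewrite [LHS]surjective_pairing; congr pair; apply/ffunP => i;
  have [h1 c1 r1] := hP i.
  by rewrite front_sign HE c1; case: (bB.1 i) => ->.
rewrite front_time HE /=; have := tle i.
suff -> : column_val a i (h i) = (n - t i)%N by rewrite /n; lia.
have [_ _] := hP (i - 1); rewrite subrK => r0.
have [_ _ t3] := tP (i - 1); rewrite subrK in t3.
have [c|c] := boolP (is_cell i (h i)); first by rewrite column_val_cell// /a eqxx.
rewrite column_val_prev// /a subrK eqxx; case: eqP => // E; congr (_ - _)%N.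
rewrite -c1 c in r0 t3; apply: t3 => //.
by move: r0; rewrite E; case: (b (i - 1) == -1) => //=; lia.
Qed.


End Realize.

(** * Countably valued variables and the rows of the process *)

Section Fibers.
Variables (R : realType) (d : measure_display) (Omega : measurableType d)
  (P : probability Omega R) (T : countType) (f : Omega -> T).
Hypothesis mf : forall c, measurable (f @^-1` [set c]).

(** Sigma-additivity, carried from nat to T by pickle. *)
Lemma esum_fibers (A : set Omega) : measurable A ->
  P A = (\esum_(c in [set: T]) P (A `&` f @^-1` [set c]))%E.
Proof.
move=> mA; pose F n := if @pickle_inv T n is Some c then A `&` f @^-1` [set c] else set0.
have mF n : measurable (F n).
  by rewrite /F; case: pickle_inv => // c; exact: measurableI.
have AF : A = \bigcup_n F n.
  apply/seteqP; split => [w Aw|w [n _]].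
    by exists (pickle (f w)) => //; rewrite /F pickleK_inv.
  by rewrite /F; case: pickle_inv => // c [].
have tF : trivIset setT F.
  move=> n m _ _ [w []]; rewrite /F.
  case En : (pickle_inv n) => [c|//] [_ /= fc].
  case Em : (pickle_inv m) => [c'|//] [_ /= fc'].
  have := @pickle_invK T n; rewrite En /= => <-.
  by have := @pickle_invK T m; rewrite Em /= => <-; rewrite -fc -fc'.
rewrite {1}AF measure_semi_bigcup//; last by rewrite -AF.
rewrite nneseries_esumT//.
rewrite (esum_support (B := @pickle T @` setT)); last first.
  move=> n Fn; split => // _; move: Fn; rewrite /F.
  have := @pickle_invK T n; case: (pickle_inv n) => [c /= <- _|_]; first by exists c.
  by rewrite measure0 eqxx.
rewrite esum_image; last by move=> c c' _ _ /(pcan_inj pickleK).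
by apply: eq_esum => c _; rewrite /F pickleK_inv.
Qed.

Lemma measurable_fibers (A : set Omega) :
  (forall w w', f w = f w' -> A w -> A w') -> measurable A.
Proof.
move=> fA; pose F c := if c \in f @` A then f @^-1` [set c] else set0.
have -> : A = \bigcup_c F c.
  apply/seteqP; split => [w Aw|w [c _]].
    by exists (f w) => //; rewrite /F mem_set//; exists w.
  rewrite /F; case: ifPn => [|//]; rewrite inE => -[w' Aw' <-] /= fw.
  by apply: fA Aw'.
apply: countable_bigcupT_measurable; first exact: countableP.
by move=> c; rewrite /F; case: ifP.
Qed.

End Fibers.

Section Rows.
Variables (R : realType) (mu0 : nat -> R) (alpha : R).
Hypotheses (hmu0 : full_support_law mu0) (halpha : 0 < alpha)
  (hinf : alpha <= hazard_inf mu0).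
Variables (L : nat) (hL : (0 < L)%N).
Variables (d : measure_display) (Omega : measurableType d) (P : probability Omega R).
Local Notation Z := 'Z_(L.*2).
Variables (xi tau : Z -> nat -> Omega -> nat).
Hypothesis hGLPP : is_GLPP P (glpp_param mu0) xi tau.
Implicit Types (x : Z) (y N : nat) (w : Omega) (a : Z -> nat -> nat).
Local Notation mu := (glpp_param mu0).

Definition table w : Z -> nat -> nat := fun x y => tau x y w.

Lemma valid_tableP w : valid_table (table w).
Proof.
case: hGLPP => h1 h2 h3 _; split => [x c|x y c]; first exact: h2.
by rewrite /table h3// -addn1 leq_add2l; case: (h1 x y c).
Qed.

Let measurable_tau y : forall x, is_cell x y -> measurable_fun setT (tau x y).
Proof.
case: hGLPP => h1 h2 h3 _; elim: y => [|y IH] x c.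
  by rewrite (_ : tau x 0%N = cst 0%N)//; apply/funext => w; exact: h2.
rewrite (_ : tau x y.+1 =
    (fun w => maxn (tau (x - 1)%R y w) (tau (x + 1)%R y w) + xi x y.+1 w)%N); last first.
  by apply/funext => w; exact: h3.
move: (c); rewrite is_cellS => cy.
apply: measurable_realfun.measurable_fun_addn; last by have [] := h1 x y c.
by apply: measurable_realfun.measurable_fun_maxn; apply: IH;
  rewrite ?is_cell_prev ?is_cell_next.
Qed.

Variable Y : nat.

(** Only the cells enter, as tau need not be measurable elsewhere. *)
Definition rows w : {ffun 'I_Y.+1 * Z -> nat} :=
  [ffun p : 'I_Y.+1 * Z => if is_cell p.2 p.1 then tau p.2 p.1 w else 0%N].

Definition next_row w : {ffun Z -> nat} :=
  [ffun x => if is_cell x Y.+1 then xi x Y.+1 w else 0%N].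

Let measurable_ffun (I : finType) (g : Omega -> {ffun I -> nat}) :
  (forall i, measurable_fun setT (fun w => g w i)) ->
  forall c, measurable (g @^-1` [set c]).
Proof.
move=> mg c.
have -> : g @^-1` [set c] =
    \bigcap_(i in [set: I]) ((fun w => g w i) @^-1` [set c i]).
  apply/seteqP; split => [w /= <- //|w gw]; apply/ffunP => i; exact: gw.
apply: fin_bigcap_measurable; first exact: finite_finset.
by move=> i _; rewrite -[X in measurable X]setTI; apply: mg.
Qed.

Lemma measurable_rows c : measurable (rows @^-1` [set c]).
Proof.
apply: measurable_ffun => -[y x]; have [cx|cx] := boolP (is_cell x y).
  rewrite (_ : (fun w => _) = tau x y); first exact: measurable_tau.
  by apply/funext => w; rewrite ffunE /= cx.
rewrite (_ : (fun w => _) = cst 0%N); first exact: measurable_cst.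
by apply/funext => w; rewrite ffunE /= (negbTE cx).
Qed.

Lemma measurable_next_row c : measurable (next_row @^-1` [set c]).
Proof.
case: hGLPP => h1 _ _ _; apply: measurable_ffun => x.
have [cx|cx] := boolP (is_cell x Y.+1).
  rewrite (_ : (fun w => _) = xi x Y.+1); first by have [] := h1 x Y cx.
  by apply/funext => w; rewrite ffunE /= cx.
rewrite (_ : (fun w => _) = cst 0%N); first exact: measurable_cst.
by apply/funext => w; rewrite ffunE /= (negbTE cx).
Qed.

Lemma rowsP w w' : rows w = rows w' <->
  forall x y, is_cell x y -> (y <= Y)%N -> tau x y w = tau x y w'.
Proof.
split => [/ffunP E x y c yY|E].
  by have := E (inord y, x); rewrite !ffunE /= inordK ?ltnS// c.
apply/ffunP => -[y x]; rewrite !ffunE /=; case: ifP => // c.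
by rewrite E// -ltnS.
Qed.

End Rows.

(** * The law of a cell truncated at a given time *)

Section TruncatedLaw.
Variables (R : realType) (mu0 : nat -> R) (alpha : R).
Hypotheses (hmu0 : full_support_law mu0) (halpha : 0 < alpha)
  (hinf : alpha <= hazard_inf mu0).
Local Notation mu := (glpp_param mu0).
Local Notation q := (sqrt_law mu0).
Local Notation G := (corr mu0).
Implicit Types (N l r v k : nat).

(** The increment k takes a cell with parents l and r to the value v, all values
    from N on being identified. *)
Definition truncated_event N l r v k : bool := minn (maxn l r + k) N == minn v N.

Definition truncated_law N l r v : R :=
  fine (\esum_(k in [set: nat])
    (if truncated_event N l r v k then mu (absdiff l r) k else 0)%:E).

Let mu_ge0 D k : 0 <= mu D k. Proof. exact: (glpp_param_ge0 hmu0 halpha hinf). Qed.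

Lemma truncated_lawE N l r v :
  (\esum_(k in [set: nat])
    (if truncated_event N l r v k then mu (absdiff l r) k else 0)%:E =
   (truncated_law N l r v)%:E)%E.
Proof.
apply: (esum_fineK (f := fun k => if truncated_event N l r v k then _ else 0)).
  by move=> k; case: ifP.
apply: (@le_lt_trans _ _ 1%E); last exact: ltry.
rewrite -(glpp_param_sum1 hmu0 halpha hinf (absdiff l r)).
by apply: le_esum => k _; case: ifP => _; rewrite lee_fin.
Qed.

Lemma truncated_law_ge0 N l r v : 0 <= truncated_law N l r v.
Proof.
by rewrite -lee_fin -truncated_lawE; apply: esum_ge0 => k _; rewrite lee_fin; case: ifP.
Qed.

(** If a parent is not below N then the cell is not either, whatever the law. *)
Lemma truncated_law_ext N l r v l' r' :
  minn l N = minn l' N -> minn r N = minn r' N ->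
  truncated_law N l r v = truncated_law N l' r' v.
Proof.
move=> El Er; have [lt|le] := ltnP (maxn l r) N.
  have -> : l' = l by lia.
  by have -> : r' = r by lia.
have sat l1 r1 k : (N <= maxn l1 r1)%N -> truncated_event N l1 r1 v k = (N == minn v N).
  by move=> le1; rewrite /truncated_event (minn_idPr _)// (leq_trans le1)// leq_addr.
have le' : (N <= maxn l' r')%N by lia.
apply: EFin_inj; rewrite -!truncated_lawE.
under eq_esum do rewrite sat//.
under [RHS]eq_esum do rewrite sat//.
by case: (N == _); rewrite ?(glpp_param_sum1 hmu0 halpha hinf)// !esum1.
Qed.

Lemma truncated_law_small N l r v : (maxn l r < v)%N -> (v < N)%N ->
  truncated_law N l r v = mu (absdiff l r) (v - maxn l r).
Proof.
move=> mv vN; apply: EFin_inj; rewrite -truncated_lawE.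
rewrite -[RHS](@esum_single R nat setT (v - maxn l r)%N) ?lee_fin//.
apply: eq_esum => k _; rewrite /truncated_event.
rewrite (_ : (_ == _) = (k == v - maxn l r)%N); last by apply/eqP/eqP; lia.
by case: eqP => // ->.
Qed.

Lemma truncated_law_large N l r v : (maxn l r < v)%N -> (N < v)%N ->
  truncated_law N.+1 l r v =
  G (N - maxn l r) (N - maxn l r + absdiff l r) / G 0 (absdiff l r).
Proof.
move=> mv vN; apply: EFin_inj; rewrite -truncated_lawE -(glpp_param_tail hmu0 halpha hinf).
rewrite [LHS](esum_shift (m := (N - maxn l r).+1)); first last.
- case=> [|s] sN; first by rewrite /= (glpp_param0 hmu0 halpha hinf); case: ifP.
  by rewrite /truncated_event ifF//; apply/negbTE/eqP; lia.
- by move=> s; case: ifP.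
apply: eq_esum => k _; rewrite addSn /truncated_event ifT//; apply/eqP; lia.
Qed.

(** Letting the truncation time go from n.+1 to n.+2 reveals something only about a
    cell that has both parents by time n and is not there yet.  The
    ratio of the two laws is the probability that its hole fills, or that it stays. *)
Lemma truncated_law_step n l r v : (maxn l r < v)%N ->
  truncated_law n.+2 l r v = truncated_law n.+1 l r v *
  (if (maxn l r <= n)%N && (n < v)%N then
     if v == n.+1 then fill_prob mu0 (n - l) (n - r)
     else 1 - fill_prob mu0 (n - l) (n - r)
   else 1).
Proof.
move=> mv; have c0 := corr_gt0 hmu0 halpha hinf 0 (absdiff l r).
have [vn|nv] := leqP v n.
  by rewrite andbF mulr1 !truncated_law_small// ltnS ltnW.
rewrite andbT [in RHS]truncated_law_large//.
have [mn|nm] := leqP (maxn l r) n; last first.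
  rewrite truncated_law_large//; last by lia.
  rewrite (_ : (n.+1 - maxn l r)%N = 0%N); last by lia.
  by rewrite (_ : (n - maxn l r)%N = 0%N) ?mulr1//; lia.
have GE k : (maxn l r <= k)%N ->
    G (k - maxn l r) (k - maxn l r + absdiff l r) = G (k - l) (k - r).
  move=> km; case/orP: (leq_total l r) => lr.
    rewrite absdiffE// (maxn_idPr lr) corrC.
    have -> : (k - r + (r - l) = k - l)%N by lia.
    by [].
  rewrite absdiffC absdiffE// (maxn_idPl lr).
  by have -> : (k - l + (l - r) = k - r)%N by lia.
rewrite GE//; have [vE|vn] := eqVneq v n.+1.
  rewrite truncated_law_small ?vE// mulrAC (fill_prob_corr hmu0 halpha hinf)
    (glpp_paramE hmu0 halpha hinf).
  congr (_ / _); case/orP: (leq_total l r) => lr.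
    rewrite absdiffE// (maxn_idPr lr) mulrC.
    have -> : (n.+1 - r + (r - l) = (n - l).+1)%N by lia.
    by have -> : (n.+1 - r = (n - r).+1)%N by lia.
  rewrite absdiffC absdiffE// (maxn_idPl lr).
  have -> : (n.+1 - l + (l - r) = (n - r).+1)%N by lia.
  by have -> : (n.+1 - l = (n - l).+1)%N by lia.
rewrite truncated_law_large//; last by lia.
rewrite mulrAC (fill_probC_corr hmu0 halpha hinf); congr (_ / _); rewrite -!subSn; try lia.
by rewrite GE// ltnW.
Qed.

End TruncatedLaw.

(** * The law of the table truncated at a given time *)

Lemma minn_saturated n p q : (n < p)%N -> (n < q)%N -> minn p n.+1 = minn q n.+1.
Proof. by move=> /minn_idPr -> /minn_idPr ->. Qed.

Section RowRecursion.
Variables (R : realType) (mu0 : nat -> R) (alpha : R).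
Hypotheses (hmu0 : full_support_law mu0) (halpha : 0 < alpha)
  (hinf : alpha <= hazard_inf mu0).
Variables (L : nat) (hL : (0 < L)%N).
Variables (d : measure_display) (Omega : measurableType d) (P : probability Omega R).
Local Notation Z := 'Z_(L.*2).
Variables (xi tau : Z -> nat -> Omega -> nat).
Hypothesis hGLPP : is_GLPP P (glpp_param mu0) xi tau.
Implicit Types (x : Z) (y Y N n : nat) (w : Omega) (a : Z -> nat -> nat).
Local Notation mu := (glpp_param mu0).
Local Notation law N a x y :=
  (truncated_law mu0 N (a (x - 1)%R y) (a (x + 1)%R y) (a x y.+1)).

Definition rows_event N Y a : set Omega := [set w | forall x y, is_cell x y ->
  (y <= Y)%N -> minn (tau x y w) N = minn (a x y) N].

Let mu_ge0 D k : 0 <= mu D k. Proof. exact: (glpp_param_ge0 hmu0 halpha hinf). Qed.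

Lemma measurable_rows_event N Y a : measurable (rows_event N Y a).
Proof.
apply: (measurable_fibers (f := rows tau Y)); first exact: (measurable_rows hL hGLPP).
by move=> w w' /rowsP E wN x y c yY; rewrite -E//; exact: wN.
Qed.

Section NextRow.
Variables (Y : nat) (w0 : Omega) (good : Z -> nat -> bool) (v : Z -> R).
Local Notation delta x := (absdiff (tau (x - 1)%R Y w0) (tau (x + 1)%R Y w0)).
Hypothesis goodE : forall x, (\esum_(k in [set: nat])
  (if good x k then mu (delta x) k else 0)%:E = (v x)%:E)%E.

(** The row being independent given the past, its product events have product
    probabilities: sum over the atoms with esum_prod_ffun. *)
Lemma next_row_product (B : set Omega) :
  B = rows tau Y @^-1` [set rows tau Y w0] `&`
      [set w | forall x, is_cell x Y.+1 -> good x (xi x Y.+1 w)] ->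
  P B = (P (rows tau Y @^-1` [set rows tau Y w0]) *
    (\prod_(x | is_cell x Y.+1) v x)%:E)%E.
Proof.
move=> BE; set past0 := _ @^-1` _ in BE *.
have mpast : measurable past0 by exact: (measurable_rows hL hGLPP).
have mnext := measurable_next_row hGLPP Y.
have mB : measurable B.
  rewrite BE; apply: measurableI => //.
  apply: (measurable_fibers (f := next_row xi Y)) => // w w' /ffunP E wg x c.
  by have := E x; rewrite !ffunE c => <-; exact: wg.
pose H x k : R := if is_cell x Y.+1 then (if good x k then mu (delta x) k else 0)
  else (k == 0%N)%:R.
have H0 x k : 0 <= H x k.
  by rewrite /H; case: ifP => _; [case: ifP|rewrite ler0n].
have HE x : (\esum_(k in [set: nat]) (H x k)%:E =
    (if is_cell x Y.+1 then v x else 1)%:E)%E.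
  rewrite /H; case: (is_cell x Y.+1) => //.
  rewrite -[RHS](@esum_single R nat setT 0%N) ?lee_fin//; apply: eq_esum => k _.
  by case: eqP.
have Ppast : past0 = past tau Y (table tau w0).
  by apply/seteqP; split => w /rowsP.
have fin : P past0 \is a fin_num by exact: fin_num_measure.
rewrite (esum_fibers P mnext mB).
transitivity (\esum_(k in [set: {ffun Z -> nat}])
    (fine (P past0) * \prod_x H x (k x))%:E)%E.
  apply: eq_esum => k _; rewrite EFinM fineK//.
  have [ok|/existsNP[x nx]] :=
    pselect (forall x, if is_cell x Y.+1 then good x (k x) else k x == 0%N).
    have -> : B `&` next_row xi Y @^-1` [set k] = past tau Y (table tau w0) `&`
        [set w | forall x, is_cell x Y.+1 -> xi x Y.+1 w = k x].
      rewrite BE Ppast; apply/seteqP; split => w /=.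
        by move=> [[wp _] wk]; split => // x c; rewrite -wk ffunE c.
      move=> [wp wk]; split; first by split => // x c; have := ok x; rewrite c wk.
      apply/ffunP => x; rewrite ffunE; have := ok x; have := wk x.
      by case: ifP => [_ ->//|_ _ /eqP ->].
    case: hGLPP => _ _ _ ->; rewrite -Ppast; congr (_ * _%:E)%E.
    rewrite [LHS]big_mkcond; apply: eq_bigr => x _; rewrite /H; have := ok x.
    by case: ifP => _ ->.
  have -> : B `&` next_row xi Y @^-1` [set k] = set0.
    rewrite BE; apply/seteqP; split => w //= [[_ wg] wk]; apply: nx.
    by rewrite -wk ffunE; case c: (is_cell x Y.+1) => //; exact: wg.
  rewrite (bigD1 x)//= (_ : H x (k x) = 0) ?mul0r ?mule0 ?measure0//.
  by move/negP: nx; rewrite /H; case: ifP => _ /negbTE ->.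
rewrite esumZ; [|exact: fine_ge0|by move=> k; exact: prodr_ge0].
rewrite (esum_prod_ffun H0 HE) fineK//; congr (_ * _%:E)%E.
by rewrite [RHS]big_mkcond.
Qed.

End NextRow.

Lemma law_ge0 N a x y : 0 <= law N a x y.
Proof. exact: (truncated_law_ge0 hmu0 halpha hinf). Qed.

(** The factor does not depend on the part of the past that the truncation hides
    (truncated_law_ext), so it comes out of the sum over all pasts. *)
Lemma probability_rows_eventS N Y a : P (rows_event N Y.+1 a) =
  (P (rows_event N Y a) * (\prod_(x | is_cell x Y.+1) law N a x Y)%:E)%E.
Proof.
set kappa := \prod_(x | _) _.
have kappa0 : 0 <= kappa by apply: prodr_ge0 => x _; exact: law_ge0.
have mrows := measurable_rows hL hGLPP (Y := Y).
have mE Y' := measurable_rows_event N Y' a.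
pose p c := fine (P (rows_event N Y a `&` rows tau Y @^-1` [set c])).
have pE c : P (rows_event N Y a `&` rows tau Y @^-1` [set c]) = (p c)%:E.
  by rewrite /p fineK//; apply: fin_num_measure; apply: measurableI.
rewrite (esum_fibers P mrows (mE Y)) muleC; under [in RHS]eq_esum do rewrite pE.
rewrite -esumZ//; last by move=> c; exact: fine_ge0.
rewrite (esum_fibers P mrows (mE Y.+1)); apply: eq_esum => c _.
rewrite EFinM -pE.
have [c0|/set0P[w0 /= w0c]] := eqVneq (rows tau Y @^-1` [set c]) set0.
  by rewrite !c0 !setI0 measure0 mule0.
have sub w : rows_event N Y.+1 a w -> rows_event N Y a w.
  by move=> h x y xy yY; apply: h => //; exact: leqW.
have cE w : rows tau Y w = c -> rows_event N Y a w <-> rows_event N Y a w0.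
  rewrite -w0c => /rowsP E; split => h x y xy yY; first by rewrite -E//; exact: h.
  by rewrite E//; exact: h.
have [in0|out0] := pselect (rows_event N Y a w0); last first.
  have -> : rows_event N Y a `&` rows tau Y @^-1` [set c] = set0.
    by apply/seteqP; split => w //= [h wc]; apply: out0; exact: ((cE w wc).1 h).
  have -> : rows_event N Y.+1 a `&` rows tau Y @^-1` [set c] = set0.
    by apply/seteqP; split => w //= [/sub h wc]; apply: out0; exact: ((cE w wc).1 h).
  by rewrite measure0 mule0.
have -> : rows_event N Y a `&` rows tau Y @^-1` [set c] = rows tau Y @^-1` [set rows tau Y w0].
  rewrite w0c; apply/seteqP; split => w /=; first by case.
  by move=> wc; split => //; exact: ((cE w wc).2 in0).
rewrite muleC; pose good x k :=
  truncated_event N (tau (x - 1)%R Y w0) (tau (x + 1)%R Y w0) (a x Y.+1) k.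
have goodE x := truncated_lawE hmu0 halpha hinf N (tau (x - 1)%R Y w0)
  (tau (x + 1)%R Y w0) (a x Y.+1).
rewrite (next_row_product (good := good) goodE); first last.
  case: hGLPP => _ _ hrec _; rewrite -w0c; apply/seteqP; split => w /=.
    move=> [h E]; split => // x cx; rewrite /good /truncated_event.
    have := h _ _ cx (leqnn _); rewrite hrec//; move: E => /rowsP E.
    by move: cx; rewrite is_cellS => cx; rewrite !E ?is_cell_prev ?is_cell_next// => ->.
  move=> [E h]; split => // x y cx; rewrite leq_eqVlt => /predU1P[yE|yY].
    rewrite yE in cx *; move: (h _ cx) => /eqP <-; rewrite hrec//.
    by move: E cx => /rowsP E; rewrite is_cellS => cx; rewrite !E ?is_cell_prev ?is_cell_next.
  by move: E => /rowsP ->//; exact: in0.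
congr (_ * _%:E)%E; apply: eq_bigr => x; rewrite is_cellS => cx.
by apply: (truncated_law_ext hmu0 halpha hinf); apply: in0;
  rewrite ?is_cell_prev ?is_cell_next.
Qed.

Section ValidTable.
Variable a : Z -> nat -> nat.
Hypothesis va : valid_table a.

Lemma probability_rows_event N Y :
  P (rows_event N Y a) = (\prod_(y < Y) \prod_(x | is_cell x y.+1) law N a x y)%:E.
Proof.
elim: Y => [|Y IH]; last by rewrite probability_rows_eventS IH big_ord_recr -EFinM.
rewrite big_ord0 -[RHS](probability_setT P); congr (P _).
apply/seteqP; split => w // _ x y c; rewrite leqn0 => /eqP y0.
by rewrite y0 in c *; rewrite va.1//; case: hGLPP => _ -> .
Qed.

Definition until_event n : set Omega := [set w | same_until n a (table tau w)].

(** Row y is not reached before time y, so finitely many rows matter. *)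
Lemma until_rows_event n Y : (n < Y)%N -> until_event n = rows_event n.+1 Y a.
Proof.
move=> nY; apply/seteqP; split => w h x y c => [_|]; first by rewrite -h.
have [yY|Yy] := leqP y Y; first by rewrite h.
have ny : (n < y)%N by exact: ltn_trans Yy.
have := column_val_ge hL va x y; rewrite column_val_cell// => /(leq_trans ny) a_gt.
have := column_val_ge hL (valid_tableP hGLPP w) x y.
by rewrite column_val_cell// => /(leq_trans ny); exact: minn_saturated.
Qed.

Lemma until_event0 : until_event 0 = setT.
Proof.
apply/seteqP; split => w // _ x [|y] c.
  by rewrite va.1// (valid_tableP hGLPP w).1.
have := column_val_ge hL va x y.+1; rewrite column_val_cell// => a_gt.
have := column_val_ge hL (valid_tableP hGLPP w) x y.+1.
by rewrite column_val_cell// => t_gt; apply: minn_saturated;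
  [exact: leq_trans a_gt|exact: leq_trans t_gt].
Qed.

Lemma measurable_until_event n : measurable (until_event n).
Proof. by rewrite (until_rows_event (leqnn n.+1)); exact: measurable_rows_event. Qed.

(** The factors that change between times n and n + 1 are those of the cells
   sitting in the holes of the front. *)
Lemma probability_until_eventS n : P (until_event n.+1) =
  (P (until_event n) * (fill_rate mu0 (front a n) (filling a n))%:E)%E.
Proof.
rewrite (until_rows_event (ltnSn n.+1)) (until_rows_event (leqW (ltnSn n))).
rewrite !probability_rows_event -EFinM; congr EFin.
pose ratio x y : R := if (maxn (a (x - 1)%R y) (a (x + 1)%R y) <= n)%N && (n < a x y.+1)%N
  then if a x y.+1 == n.+1 then fill_prob mu0 (n - a (x - 1)%R y) (n - a (x + 1)%R y)
       else 1 - fill_prob mu0 (n - a (x - 1)%R y) (n - a (x + 1)%R y)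
  else 1.
rewrite (eq_bigr (fun y : 'I_n.+2 => (\prod_(x | is_cell x y.+1) law n.+1 a x y) *
    \prod_(x | is_cell x y.+1) ratio x y)); last first.
  move=> y _; rewrite -big_split; apply: eq_bigr => x c.
  by rewrite (truncated_law_step hmu0 halpha hinf)//; exact: va.2.
rewrite big_split/=; congr (_ * _).
rewrite (exchange_big_dep xpredT)//= /fill_rate; apply: eq_bigr => x _.
have ratio_hole y : is_cell x y.+1 -> ratio x y != 1 ->
    hole (front a n).1 x /\ y = front_height a n x.
  rewrite is_cellS => c; rewrite /ratio; case: ifP; last by rewrite eqxx.
  rewrite geq_max => /andP[/andP[l1 l2] l3] _.
  have yx : front_height a n x = y.
    apply: front_heightP => //; first by rewrite column_val_prev.
    by rewrite column_val_cell ?is_cellS.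
  split => //; rewrite hole_front yx c /=.
  suff -> : front_height a n (x + 1) = y by rewrite is_cell_next.
  apply: front_heightP => //; first by rewrite column_val_cell ?is_cell_next.
  by rewrite column_val_next// is_cellS.
have [hx|nhx] := boolP (hole (front a n).1 x); last first.
  rewrite big1; last first.
    move=> y c; apply/eqP; apply: contraNT nhx => /(ratio_hole _ c)[].
    by [].
  by rewrite inE (negbTE nhx)/= /hole_prob (negbTE nhx) subr0.
have [c Hx e1 e2 e3] := hole_heights hL va hx.
have Hn : (front_height a n x < n.+2)%N by rewrite ltnS leqW// front_height_le.
rewrite (bigD1 (Ordinal Hn))/=; last by rewrite is_cellS.
rewrite big1 ?mulr1; last first.
  move=> y /andP[cy yN]; apply/eqP; apply: contraNT yN => /(ratio_hole _ cy)[_ yE].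
  by apply/eqP/val_inj.
have h1 := column_val_height hL va n x; have h2 := column_val_height hL va n (x + 1).
have h3 := column_val_heightS hL va n x.
rewrite /ratio e1 e2 geq_max h1 h2 -e3 h3 /= inE hx /= -e3.
by rewrite /hole_prob hx !front_time.
Qed.

Lemma probability_until_event_gt0 n : (0 < P (until_event n))%E.
Proof.
elim: n => [|n IH]; first by rewrite until_event0 probability_setT.
rewrite probability_until_eventS mule_gt0// lte_fin.
by apply: (fill_rate_gt0 hmu0 halpha hinf) => i; rewrite inE => /andP[].
Qed.

End ValidTable.

End RowRecursion.

(** * The front as a Markov chain *)

Section Uniqueness.
Variables (R : realType) (T : choiceType) (S : set T) (K : T -> T -> R) (x0 : T).
Hypothesis lawK : forall x, S x -> is_law S (K x).
Hypothesis reach : forall x, S x -> exists (p : nat -> T) (n : nat),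
  [/\ p 0%N = x, p n = x0 &
      forall k, (k < n)%N -> [/\ S (p k), S (p k.+1) & 0 < K (p k) (p k.+1)]].

Lemma esum_exchange (A B : set T) (f : T -> T -> \bar R) :
  (forall x y, A x -> B y -> 0 <= f x y)%E ->
  (\esum_(x in A) \esum_(y in B) f x y = \esum_(y in B) \esum_(x in A) f x y)%E.
Proof.
move=> f0; rewrite !esum_esum//; last by move=> y x By Ax; exact: f0.
rewrite (reindex_esum (B `*`` (fun=> A)) _ (fun z => (z.2, z.1)))//; split.
- by move=> [y x] [/= By Ax].
- by move=> [y x] [y' x'] _ _ [-> ->].
- by move=> [x y] [/= Ax By]; exists (y, x).
Qed.

(** The minimum of two invariant laws is again invariant: it is mapped below
   itself and keeps its total mass.  At x0 it coincides with one of the laws,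
   hence, x0 being reachable from everywhere, it coincides with it everywhere. *)
Lemma invariant_law_unique (nu nu' : T -> R) :
  is_invariant_law S K nu -> is_invariant_law S K nu' -> nu' =1 nu.
Proof.
wlog : nu nu' / nu x0 <= nu' x0.
  move=> H i1 i2; case/orP: (le_total (nu x0) (nu' x0)) => le; first exact: H.
  by move=> x; apply/esym; exact: H.
move=> le0 [[nu_ge0 nu_out nu1] nuK] [[nu'_ge0 nu'_out nu'1] nu'K].
pose m x := Num.min (nu x) (nu' x).
have m_nu x : m x <= nu x by rewrite ge_min lexx.
have m_nu' x : m x <= nu' x by rewrite ge_min lexx orbT.
have m_ge0 x : 0 <= m x by rewrite le_min nu_ge0 nu'_ge0.
have K_ge0 x y : S x -> 0 <= K x y by move=> /lawK[].
have mK_ge0 x y : 0 <= m x * K x y.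
  have [Sx|nSx] := pselect (S x); first by rewrite mulr_ge0// K_ge0.
  by rewrite /m nu_out// nu'_out// minxx mul0r.
have mK_le y : S y -> (\esum_(x in S) (m x * K x y)%:E <= (m y)%:E)%E.
  move=> Sy; rewrite EFin_min le_min -nuK// -nu'K//; apply/andP; split;
    by apply: le_esum => x Sx; rewrite lee_fin ler_wpM2r ?K_ge0.
have mK_fin y : S y -> (\esum_(x in S) (m x * K x y)%:E =
    (fine (\esum_(x in S) (m x * K x y)%:E))%:E)%E.
  by move=> Sy; apply: esum_fineK => //; apply: le_lt_trans (mK_le y Sy) (ltry _).
have m_fin : (\esum_(x in S) (m x)%:E < +oo)%E.
  apply: (@le_lt_trans _ _ 1%E); last exact: ltry.
  by rewrite -nu1; apply: le_esum => x _; rewrite lee_fin.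
have total : (\esum_(y in S) (fine (\esum_(x in S) (m x * K x y)%:E))%:E =
    \esum_(x in S) (m x)%:E)%E.
  transitivity (\esum_(y in S) \esum_(x in S) (m x * K x y)%:E)%E.
    by apply: eq_esum => y Sy; rewrite -mK_fin.
  rewrite esum_exchange; last by move=> x y _ _; rewrite lee_fin.
  apply: eq_esum => x Sx; have [Kx0 _ Kx1] := lawK Sx.
  by rewrite esumZ// Kx1 mule1.
have mK y : S y -> (\esum_(x in S) (m x * K x y)%:E = (m y)%:E)%E.
  move=> Sy; rewrite mK_fin//; congr EFin; move: y Sy.
  apply: esum_eq_le.
  - by move=> y; apply: fine_ge0; apply: esum_ge0 => x _; rewrite lee_fin.
  - by move=> y Sy; rewrite -lee_fin -mK_fin// mK_le.
  - by rewrite total.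
  - by rewrite total.
have push x y : S x -> S y -> 0 < K x y -> m x < nu x -> m y < nu y.
  move=> Sx Sy Kxy mx; rewrite lt_neqAle m_nu andbT; apply/eqP => my.
  have := @esum_eq_le R T S (fun z => m z * K z y) (fun z => nu z * K z y).
  move=> /(_ _ _ _ _ x Sx) H; have : m x * K x y = nu x * K x y.
    apply: H => //.
    - by move=> z Sz; rewrite ler_wpM2r ?K_ge0.
    - by rewrite nuK// mK// my.
    - by rewrite mK// ltry.
  by move/(mulIf (lt0r_neq0 Kxy)) => E; rewrite E ltxx in mx.
have m0 : m x0 = nu x0 by exact: min_idPl.
have mE x : S x -> m x = nu x.
  move=> Sx; apply/eqP; rewrite eq_le m_nu leNgt; apply/negP => mx.
  have [p [n [p0 pn pK]]] := reach Sx.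
  suff : m x0 < nu x0 by rewrite m0 ltxx.
  rewrite -pn; elim: n pK {pn} => [|n IH] pK; first by rewrite p0.
  have [S1 S2 K12] := pK n (ltnSn n).
  by apply: push S1 S2 K12 (IH _) => k kn; apply: pK; exact: ltnW.
have le x : S x -> nu x <= nu' x by move=> Sx; rewrite -mE.
move=> x; have [Sx|nSx] := pselect (S x); last by rewrite nu_out// nu'_out.
apply/esym; move: x Sx; apply: esum_eq_le => //; first by rewrite nu1 nu'1.
by rewrite nu1 ltry.
Qed.

End Uniqueness.

Section Chain.
Variables (R : realType) (mu0 : nat -> R) (alpha : R).
Hypotheses (hmu0 : full_support_law mu0) (halpha : 0 < alpha)
  (hinf : alpha <= hazard_inf mu0).
Variables (L : nat) (hL : (0 < L)%N).
Local Notation Z := 'Z_(L.*2).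
Local Notation state := ({ffun Z -> int} * {ffun Z -> nat})%type.

Lemma valid_table_row : valid_table (fun (_ : Z) y => y).
Proof. by split => // x y _; rewrite maxnn. Qed.

Lemma front0_unique (a a' : Z -> nat -> nat) :
  valid_table a -> valid_table a' -> front a 0 = front a' 0.
Proof.
move=> va va'; apply: (same_until_front hL va va' _ (leqnn 0)).1 => x [|y] c.
  by rewrite va.1// va'.1.
have := column_val_ge hL va x y.+1; have := column_val_ge hL va' x y.+1.
rewrite !column_val_cell// => l l'.
by apply: minn_saturated; [exact: leq_trans l'|exact: leq_trans l].
Qed.

(** The state is the front of a table, which can be extended so that the step takes
    place; fronts of tables lie in Btilde. *)
Lemma step_Btilde (x : state) (A : {set Z}) : Btilde L x ->
  (forall i, i \in A -> hole x.1 i) -> Btilde L (step x A).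
Proof.
move=> /(realize_state hL)[a [n [va <-]]] /(extend_table hL va)[a' [va' sa <-]].
have [-> _] := same_until_front hL va va' sa (leqnn n).
by rewrite -front_step//; exact: front_Btilde.
Qed.

Lemma fill_kernel_law (x : state) : Btilde L x -> is_law (Btilde L) (fill_kernel mu0 x).
Proof.
move=> xS; have out y : ~ Btilde L y -> fill_kernel mu0 x y = 0.
  move=> yS; apply/eqP; apply: contrapT => /negP /fill_kernel_neq0[A Ah yE].
  by apply: yS; rewrite yE; exact: step_Btilde.
split => //; first by move=> y; exact: (fill_kernel_ge0 hmu0 halpha hinf).
rewrite -[RHS](esum_fill_kernel hmu0 halpha hinf x); apply: esum_support => y.
rewrite eqe => yN0; split => // _; apply: contrapT => /out y0.
by rewrite y0 eqxx in yN0.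
Qed.

Lemma fill_kernel_front_gt0 (a : Z -> nat -> nat) n : valid_table a ->
  0 < fill_kernel mu0 (front a n) (front a n.+1).
Proof.
move=> va; have Ah i : i \in filling a n -> hole (front a n).1 i.
  by rewrite inE => /andP[].
rewrite (front_step hL va) fill_kernel_step//.
exact: (fill_rate_gt0 hmu0 halpha hinf).
Qed.

Section Process.
Variables (d : measure_display) (Omega : measurableType d) (P : probability Omega R).
Variables (xi tau : Z -> nat -> Omega -> nat).
Hypothesis hGLPP : is_GLPP P (glpp_param mu0) xi tau.

Let vt w := valid_tableP hGLPP w.

Lemma path_until_event (a : Z -> nat -> nat) n (x : nat -> state) : valid_table a ->
  (forall k, (k <= n)%N -> front a k = x k) ->
  [set w | forall k, (k <= n)%N -> Ftilde tau k w = x k] = until_event tau a n.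
Proof.
move=> va ax; apply/seteqP; split => w /= h.
  apply: (front_same_until hL va (vt w)) => k kn; rewrite ax//.
  by rewrite -h.
by move=> k kn; rewrite -ax//; have [-> _] := same_until_front hL va (vt w) h kn.
Qed.

Lemma front_markov_chain : is_markov_chain P (Btilde L) (Ftilde tau) (@fill_kernel R mu0 L).
Proof.
split.
- exact: fill_kernel_law.
- by move=> n w; apply: (front_Btilde hL (vt w)).
- move=> n x; apply: (measurable_fibers (f := rows tau n)).
    exact: (measurable_rows hL hGLPP).
  move=> w w' /rowsP E <-; apply/esym.
  apply: (same_until_front hL (vt w) (vt w') _ (leqnn n)).1 => z y c.
  have [yn|ny] := leqP y n; first by rewrite /table E.
  have := column_val_ge hL (vt w) z y; have := column_val_ge hL (vt w') z y.
  rewrite !column_val_cell// => /(leq_trans ny) t' /(leq_trans ny) t.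
  exact: minn_saturated.
move=> n x.
set E := [set w | forall k, (k <= n.+1)%N -> Ftilde tau k w = x k].
have EE' w : E w -> forall k, (k <= n)%N -> Ftilde tau k w = x k.
  by move=> Ew k kn; apply: Ew; exact: leqW.
have [noE|/existsNP[w0 /contrapT w0E]] :=
    pselect (forall w, ~ forall k, (k <= n)%N -> Ftilde tau k w = x k).
  have -> : E = set0 by apply/seteqP; split => w // /EE' /noE.
  rewrite [X in (P X * _)%E](_ : _ = set0) ?measure0 ?mul0e//.
  by apply/seteqP; split => w // /noE.
have [K0|/fill_kernel_neq0[A Ah xE]] :=
    eqVneq (fill_kernel mu0 (x n) (x n.+1)) 0.
  rewrite K0 mule0; have -> : E = set0; last by rewrite measure0.
  apply/seteqP; split => w // Ew; have := fill_kernel_front_gt0 n (vt w).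
  rewrite -[front _ n]/(Ftilde tau n w) -[front _ n.+1]/(Ftilde tau n.+1 w).
  by rewrite !Ew// K0 ltxx.
have Ah' i : i \in A -> hole (front (table tau w0) n).1 i.
  by rewrite -[front _ n]/(Ftilde tau n w0) w0E//; exact: Ah.
have [a [va sa Aa]] := extend_table hL (vt w0) Ah'.
have ax k : (k <= n)%N -> front a k = x k.
  by move=> kn; have [<- _] := same_until_front hL (vt w0) va sa kn; exact: w0E.
have ax' k : (k <= n.+1)%N -> front a k = x k.
  rewrite leq_eqVlt => /predU1P[->|]; last exact: ax.
  by rewrite (front_step hL va) ax// Aa -xE.
rewrite /E (path_until_event va ax') (path_until_event va ax).
rewrite (probability_until_eventS hmu0 halpha hinf hL hGLPP va).
by rewrite Aa (ax n)// xE fill_kernel_step.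
Qed.

(** Every state is visited with positive probability, so the kernel is
   determined by the chain. *)
Lemma markov_kernel_unique (K : state -> state -> R) :
  is_markov_chain P (Btilde L) (Ftilde tau) K ->
  forall x, Btilde L x -> K x =1 fill_kernel mu0 x.
Proof.
move=> [_ _ _ hK] x /(realize_state hL)[a [n [va <-]]] y.
have [_ _ _ hK0] := front_markov_chain.
pose p k := if (k <= n)%N then front a k else y.
have := hK n p; rewrite hK0 /p ltnn leqnn.
rewrite (path_until_event va); last by move=> k ->.
have mU := measurable_until_event hL hGLPP va n.
have Ufin : P (until_event tau a n) \is a fin_num by exact: fin_num_measure.
have := probability_until_event_gt0 hmu0 halpha hinf hL hGLPP va n.
rewrite -(fineK Ufin) lte_fin -!EFinM => U0 [].
by move/(mulfI (lt0r_neq0 U0)).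
Qed.

End Process.
End Chain.

Theorem theorem15 (R : realType) (mu0 : nat -> R) (alpha : R)
  (hmu0 : full_support_law mu0)
  (halpha : 0 < alpha) (hinf : alpha <= hazard_inf mu0)
  (L : nat) (hL : (0 < L)%N)
  (d : measure_display) (Omega : measurableType d) (P : probability Omega R)
  (xi tau : 'Z_(L.*2) -> nat -> Omega -> nat)
  (hGLPP : is_GLPP P (glpp_param mu0) xi tau) :
  (exists K, is_markov_chain P (Btilde L) (Ftilde tau) K) /\
  forall K, is_markov_chain P (Btilde L) (Ftilde tau) K ->
    exists nut : {ffun 'Z_(L.*2) -> int} * {ffun 'Z_(L.*2) -> nat} -> R,
      [/\ is_unique_invariant_law (Btilde L) K nut,
          partition_function mu0 L \is a fin_num,
          forall b t, Bset b -> Tset b t ->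
            nut (b, t) = (fine (partition_function mu0 L))^-1 * weight mu0 b t &
          forall b, Bset b ->
            front_law nut b =
            (((fine (partition_function mu0 L))^-1)%:E *
             \esum_(t in Tset b) (weight mu0 b t)%:E)%E].
Proof.
split.
  exists (@fill_kernel R mu0 L); exact: (front_markov_chain hmu0 halpha hinf hL hGLPP).
move=> K chainK; have KE := markov_kernel_unique hmu0 halpha hinf hL hGLPP chainK.
have W_ge0 := link_product_ge0 hmu0 halpha hinf (L := L).
set ZL := partition_function mu0 L.
have ZE : ZL = (\esum_(x in Btilde L) (link_product mu0 x)%:E)%E.
  exact: (partition_functionE hmu0 halpha hinf).
have Z_fin : ZL \is a fin_num.
  rewrite ge0_fin_numE; first exact: (partition_function_lty hmu0 halpha hinf).
  by rewrite ZE; apply: esum_ge0 => x _; rewrite lee_fin.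
pose x0 := front (fun (_ : 'Z_(L.*2)) y => y) 0.
have Sx0 : Btilde L x0 by exact: (front_Btilde hL (valid_table_row L)).
have Z_gt0 : 0 < fine ZL.
  rewrite -lte_fin fineK// ZE.
  apply: (@lt_le_trans _ _ (link_product mu0 x0)%:E).
    by rewrite lte_fin; exact: (link_product_gt0 hmu0 halpha hinf).
  rewrite -(@esum_set1 R _ x0 (fun x => (link_product mu0 x)%:E)) ?lee_fin//.
  by apply: subset_esum => _ ->.
have Zi_ge0 : 0 <= (fine ZL)^-1 by rewrite invr_ge0 ltW.
pose nut x := if `[< Btilde L x >] then (fine ZL)^-1 * link_product mu0 x else 0.
have nutE x : Btilde L x -> nut x = (fine ZL)^-1 * link_product mu0 x.
  by move=> xS; rewrite /nut asboolT.
exists nut; split => //.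
- have lawK x : Btilde L x -> is_law (Btilde L) (K x) by case: chainK => + _ _ _; exact.
  have inv : is_invariant_law (Btilde L) K nut.
    split; first split.
    + by move=> x; rewrite /nut; case: asboolP => // _; exact: mulr_ge0.
    + by move=> x xS; rewrite /nut asboolF.
    + rewrite (eq_esum (fun x xS => congr1 EFin (nutE x xS))) esumZ// -ZE.
      by rewrite -[ZL in X in (_ * X)%E]fineK// -EFinM mulVf// gt_eqF.
    + move=> y yS; rewrite nutE// EFinM -(esum_weight_kernel hmu0 halpha hinf yS).
      rewrite -esumZ//; last first.
        by move=> x; rewrite mulr_ge0// (fill_kernel_ge0 hmu0 halpha hinf).
      by apply: eq_esum => x xS; rewrite nutE// KE// mulrA.
  split => // nu' inv'; apply: (invariant_law_unique lawK _ inv inv').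
  move=> x /(realize_state hL)[a [n [va <-]]].
  have [a' [m [va' sa nm am]]] := flatten_table hL n va.
  have [-> _] := same_until_front hL va va' sa (leqnn n).
  exists (fun k => front a' (n + k)%N), (m - n)%N; split.
  + by rewrite addn0.
  + by rewrite subnKC// am; exact: front0_unique (valid_table_row L).
  + move=> k _; have S1 k' := front_Btilde hL va' k'; split => //.
    by rewrite KE// addnS; exact: (fill_kernel_front_gt0 hmu0 halpha hinf).
- by move=> b t bB tT; rewrite nutE// (weightE hmu0 halpha hinf (x := (b, t))).
- move=> b bB; rewrite /front_law.
  transitivity (\esum_(t in Tset b) ((fine ZL)^-1 * link_product mu0 (b, t))%:E)%E.
    by apply: eq_esum => t tT; rewrite nutE.
  rewrite esumZ//; congr (_ * _)%E; apply: eq_esum => t tT.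
  by rewrite (weightE hmu0 halpha hinf (x := (b, t))).
Qed.
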